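(* Let $E\subset[0,1]$ be Lebesgue measurable with measure $|E|>0$, let $\epsilon>0$, and put $$r=\left\lceil\left(\frac{6(|E|+1)}{\epsilon|E|}\right)^8\right\rceil .$$ Then there is a partition $\{S_j\}_{j=1}^r$ of $\mathbb{Z}$ (with possibly empty sets) such that for all $j=1,\dots,r$ and all $f\in S(S_j)$, $$(1-\epsilon)|E|\,\|f\|^2\le\|P_E(f)\|^2\le(1+\epsilon)|E|\,\|f\|^2 .$$
   Context: For $J\subset\mathbb{Z}$, $S(J)$ denotes the closure in (complex) $L^2([0,1])$ of $\operatorname{span}\{e^{2\pi\mathrm{i}nt}\}_{n\in J}$. For measurable $E\subset[0,1]$, $P_E$ is the orthogonal projection of $L^2[0,1]$ onto $L^2(E)$, i.e. $P_E(f)=f\cdot\chi_E$. Norms are $L^2[0,1]$ norms and $|E|$ is Lebesgue measure. *)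

(* Defs.v *)
From mathcomp Require Import all_boot all_order all_algebra.
From mathcomp Require Import complex.
From mathcomp Require Import all_classical all_reals all_analysis.

Set Implicit Arguments.
Unset Strict Implicit.
Unset Printing Implicit Defensive.
Import Order.TTheory GRing.Theory Num.Theory.
Import numFieldNormedType.Exports.

Local Open Scope classical_set_scope.
Local Open Scope ring_scope.

(* The real line with the sigma-algebra of Lebesgue measurable sets, i.e. the
   completion of the Borel one (see [completed_caratheodory_measurable]); the
   default measurable structure on R is only the Borel one. *)
Notation lebesgueType R := (caratheodory_type (@wlength R idfun)^*%mu).

Section L2.
Context {R : realType}.
Implicit Types (E : set R) (J : set int) (f g : R -> R[i]).

Definition lebesgue_measurable E : Prop :=
  measurable (E : set (lebesgueType R)).

(* |E|; only meaningful for sets of finite measure. *)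
Definition vol E : R := fine (completed_lebesgue_measure E).

(* The norm of L^2([0,1]); the values of f outside [0,1] are ignored. *)
Definition L2norm f : \bar R :=
  'N[@completed_lebesgue_measure R]_2%:E[
    (fun x => (Normc.normc (f x))%:E) \_ `[0, 1]].

(* Representatives of elements of L^2([0,1]).  Membership in [L2] and in the
   spaces [trig_space J] and the norms are invariant under almost everywhere
   equality on [0,1], so there is no need to pass to the quotient. *)
Definition L2 : set (R -> R[i]) :=
  [set f | measurable_fun (`[0, 1] : set (lebesgueType R))
             (fun x => complex.Re (f x) : R) /\
           measurable_fun (`[0, 1] : set (lebesgueType R))
             (fun x => complex.Im (f x) : R) /\
           (L2norm f < +oo)%E].

(* e^{2 pi i n x} *)
Definition expi (n : int) : R -> R[i] :=
  fun x => (cos (2 * pi * n%:~R * x) +i* sin (2 * pi * n%:~R * x))%C.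

Definition trig_span J : set (R -> R[i]) :=
  [set p | exists (s : seq int) (c : int -> R[i]),
     [set` s] `<=` J /\ p = (fun x => \sum_(n <- s) c n * expi n x)].

(* S(J), the L^2-closure of the span of the e^{2 pi i n x}, n in J. *)
Definition trig_space J : set (R -> R[i]) :=
  [set f | L2 f /\ forall e : R, 0 < e ->
     exists2 p, trig_span J p & (L2norm (fun x => f x - p x)%R < e%:E)%E].

(* P_E, the orthogonal projection onto L^2(E). *)
Definition restrict_proj E f : R -> R[i] := fun x => f x * (\1_E x)%:C%C.

End L2.

(* Main.v *)
Require Import Defs.
From mathcomp Require Import all_boot all_order all_algebra.
From mathcomp Require Import complex polyrcf.
From mathcomp Require Import all_classical all_reals all_analysis.
From mathcomp Require Import measurable_realfun.
From mathcomp Require Import ring lra.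

Set Implicit Arguments.
Unset Strict Implicit.
Unset Printing Implicit Defensive.
Import Order.TTheory GRing.Theory Num.Theory.
Import numFieldNormedType.Exports.
Local Open Scope classical_set_scope.
Local Open Scope ring_scope.

(** By density of the trigonometric polynomials and a compactness argument over
    the finite sets of frequencies, it is enough to colour finitely many
    frequencies.  There the claim says that the Gram matrix [A] of the
    exponentials on [E] and its complement [1 - A], two contractions with
    constant diagonal, can both be paved: for a colouring with [O(theta^-2)]
    colours, the diagonal blocks exceed the diagonal entry by at most [theta].
    This is the paving form of the Kadison-Singer theorem, proved by the
    interlacing polynomials of Marcus, Spielman and Srivastava.  The polynomial
    [f u = prod_j det (X + diag (u _ j) A)] is affine in every [u i j], and
    shifting [u i (c i)] by [-1] for all [i] turns it into the product of the
    characteristic polynomials of the blocks of the colouring [c].  Averaging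
    over the colour of [i] is the operator [1 - r^-1 sum_j d/du_ij], which
    preserves real stability, so the colours can be fixed one at a time without
    increasing the largest root.  The largest root of the full average is
    controlled by a barrier argument, started at a point where the logarithmic
    derivatives of [f] are at most [1 / tau]. *)

(** * Rational functions mapping the upper half plane to the lower one *)

(** Interlacing polynomials only bound the form on a block from above. The lower bound is the upper
    bound for [1 - A], so a frequency is coloured by a pair, one colour for each of the two pavings.
    This squares the number of colours: about [(40 / theta ^+ 2) ^+ 2] with [theta = eps * |E|],
    which for [theta < 1] stays within the eighth power of the theorem.

    Both the selection of colours and the barrier rest on one fact in one variable. A real rational
    function that maps the upper half plane to the closed lower one is an affine function of
    nonpositive slope plus terms [c / (x - y)] with [c >= 0]; hence it is decreasing and convex to
    the right of its poles. In the selection the variable is [x], the function is a partial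
    derivative divided by the polynomial, and monotonicity does the work of interlacing. In the
    barrier [x] is frozen at a real point, the variable is a shift of the matrix along a line, and
    convexity is needed as well. Stability supplies the half plane condition in both cases. *)

Section Nevanlinna.
Variable R : rcfType.
Local Notation C := R[i].
Local Notation toC := (real_complex R).
Local Notation "p ^C" := (map_poly toC p) (at level 1, format "p ^C").
Local Notation Re := (@complex.Re R).
Local Notation Im := (@complex.Im R).
Implicit Types (p q N D : {poly R}) (P Q E : {poly C}).

Lemma ImD (x y : C) : Im (x + y) = Im x + Im y.
Proof. by case: x y => [a b] [c d]. Qed.

Lemma ImB (x y : C) : Im (x - y) = Im x - Im y.
Proof. by case: x y => [a b] [c d]. Qed.

Lemma ImMr (x : C) (a : R) : Im (x * toC a) = Im x * a.
Proof. by case: x => b c /=; rewrite mulr0 add0r. Qed.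

Lemma Im_sum I (s : seq I) (F : I -> C) : Im (\sum_(i <- s) F i) = \sum_(i <- s) Im (F i).
Proof. by elim/big_rec2: _ => // i x y _ <-; rewrite ImD. Qed.

Lemma Re_sum I (s : seq I) (F : I -> C) : Re (\sum_(i <- s) F i) = \sum_(i <- s) Re (F i).
Proof. by elim/big_rec2: _ => // i x y _ <-; case: (F i) (y) => ? ? [? ?]. Qed.

Lemma Im0_toC (z : C) : Im z = 0 -> z = toC (Re z).
Proof. by case: z => a b /= ->. Qed.

Definition Im_poly P : {poly R} := \poly_(i < size P) Im P`_i.

Lemma coef_Im_poly P k : (Im_poly P)`_k = Im P`_k.
Proof.
by rewrite coef_poly; case: ltnP => // h; rewrite nth_default.
Qed.

Lemma horner_Im_poly P (x : R) : (Im_poly P).[x] = Im P.[toC x].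
Proof.
rewrite (horner_coef_wide x (size_poly _ _)) horner_coef Im_sum.
by apply: eq_bigr => i _; rewrite coef_Im_poly -rmorphXn ImMr.
Qed.

Lemma horner_toC p (x : R) : p^C.[toC x] = toC p.[x].
Proof. exact: horner_map. Qed.

Lemma horner_conj p (z : C) : p^C.[z^*%C] = (p^C.[z])^*%C.
Proof.
rewrite -horner_map -map_poly_comp; congr _.[_]; apply: eq_map_poly => x /=.
by rewrite oppr0.
Qed.

Lemma horner_le0_near q :
  (exists2 e0, 0 < e0 & forall e, 0 < e -> e < e0 -> q.[e] <= 0) -> q.[0] <= 0.
Proof.
case=> e0 e0_gt0 H; rewrite leNgt; apply/negP => q0.
have [d d_gt0 Hd] := poly_cont 0 q q0.
set e := Num.min d e0 / 2.
have m_gt0 : 0 < Num.min d e0 by rewrite lt_min d_gt0.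
have [md me] : Num.min d e0 <= d /\ Num.min d e0 <= e0 by rewrite !ge_min !lexx orbT.
have e_gt0 : 0 < e by rewrite divr_gt0.
have := H e e_gt0 _; rewrite /e => /(_ ltac:(lra)) le0.
have := Hd e; rewrite /e subr0 gtr0_norm ?divr_gt0// => /(_ ltac:(lra)).
rewrite ltr_norml => /andP[]; lra.
Qed.

(* Expand at s = rho + e w and let the real e tend to 0. *)
Lemma Im_blowup_near (N D : {poly C}) (rho w : C) m E :
    (exists2 e0, 0 < e0 & forall e, 0 < e -> e < e0 ->
       Im (N.[rho + w * toC e] * (D.[rho + w * toC e])^*%C) <= 0) ->
    D = E * ('X - rho%:P) ^+ m ->
  Im (N.[rho] * (E.[rho])^*%C * (w^*%C) ^+ m) <= 0.
Proof.
move=> [e0 e0_gt0 He0] DE.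
set L := rho%:P + w *: 'X.
(* For real [e], conjugating the value is the same as conjugating the coefficients, so [P] is a
   polynomial in [e] and the limit is plain continuity. *)
set P := (N \Po L) * map_poly (@conjc R) (E \Po L) * ((w^*%C) ^+ m)%:P.
have LE (e : R) : L.[toC e] = rho + w * toC e by rewrite !hornerE.
have PE (e : R) : P.[toC e] =
    N.[rho + w * toC e] * (E.[rho + w * toC e])^*%C * (w^*%C) ^+ m.
  rewrite !hornerM horner_comp LE hornerC.
  rewrite -{2}(conjc_real e) horner_map horner_comp LE //.
have := @horner_le0_near (Im_poly P).
rewrite horner_Im_poly PE rmorph0 mulr0 addr0; apply.
exists e0 => // e e_gt0 lte; rewrite horner_Im_poly PE.
have := He0 e e_gt0 lte; rewrite DE hornerM horner_exp !hornerE.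
have -> : rho + w * toC e - rho = w * toC e by rewrite addrAC subrr add0r.
rewrite rmorphM rmorphXn rmorphM /= oppr0 exprMn.
rewrite [_^*%C ^+ m * _ as X in _ * (_ * X)]mulrC.
have -> : (Complex e 0) ^+ m = toC (e ^+ m) by rewrite rmorphXn.
rewrite mulrA [X in _ * X]mulrC mulrA ImMr.
by rewrite pmulr_lle0 ?exprn_gt0// mulrA.
Qed.

Lemma stay_in_UHP (rho w : C) : 0 < Im rho \/ (Im rho = 0 /\ 0 < Im w) ->
  exists2 e0 : R, 0 < e0 &
    forall e : R, 0 < e -> e < e0 -> 0 < Im (rho + w * toC e).
Proof.
case=> [h|[h1 h2]]; last first.
  by exists 1 => // e e_gt0 _; rewrite ImD ImMr h1 add0r mulr_gt0.
exists (Im rho / (`|Im w| + 1)); first by rewrite divr_gt0// ltr_wpDl.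
move=> e e_gt0; rewrite ltr_pdivlMr ?ltr_wpDl// => lte.
rewrite ImD ImMr.
have : - `|Im w| <= Im w by rewrite lerNl -normrN ler_norm.
have := normr_ge0 (Im w); move: `|Im w| (Im w) lte => ay y; nra.
Qed.

(** * Poles are real and simple, with positive residues *)

Section Poles.
Variables N D : {poly R}.
Hypothesis ND : forall s : C, 0 < Im s -> Im (N^C.[s] * (D^C.[s])^*%C) <= 0.

Lemma Im_blowup (rho w : C) m E :
    D^C = E * ('X - rho%:P) ^+ m ->
    0 < Im rho \/ (Im rho = 0 /\ 0 < Im w) ->
  Im (N^C.[rho] * (E.[rho])^*%C * (w^*%C) ^+ m) <= 0.
Proof.
move=> DE /stay_in_UHP[e0 e0_gt0 He0]; apply: (Im_blowup_near _ DE).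
by exists e0 => // e ? ?; apply/ND/He0.
Qed.

Lemma exists_root_turn (m : nat) (z : C) : (0 < m)%N ->
  exists w : C, Im (z * (w^*%C) ^+ m) = Re (z * z^*%C) /\
    w ^+ m = - 'i%C * z /\ ((1 < m)%N -> 0 <= Im w).
Proof.
move=> m_gt0; exists (m.-root (- 'i%C * z)); split; last first.
  split; first by rewrite rootCK.
  move=> m1; have := Im_rootC_ge0 (- 'i%C * z) m1.
  by rewrite -complexIm ler0c.
rewrite -rmorphXn rootCK//=; case: z => a b /=; ring.
Qed.

Lemma Re_mulJ_gt0 (z : C) : z != 0 -> 0 < Re (z * z^*%C).
Proof.
case: z => a b; rewrite eq_complex negb_and /=.
have -> : a * a - b * - b = a ^+ 2 + b ^+ 2 by ring.
case/orP => h.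
  by rewrite ltr_pwDl ?sqr_ge0// lt_neqAle sqr_ge0 eq_sym sqrf_eq0 h.
by rewrite ltr_wpDl ?sqr_ge0// lt_neqAle sqr_ge0 eq_sym sqrf_eq0 h.
Qed.

(** Around a pole in the open upper half plane every direction [w] is allowed, and one of them has
    the wrong sign. A pole in the lower half plane is reflected, as [N] and [D] are real. *)
Lemma pole_real (rho : C) : D != 0 -> N^C.[rho] != 0 -> root D^C rho -> Im rho = 0.
Proof.
move=> D0.
have key (r : C) : N^C.[r] != 0 -> root D^C r -> 0 < Im r -> False.
  move=> Nr rD r_gt0.
  have [m [E]] := multiplicity_XsubC D^C r; rewrite map_poly_eq0 D0 /= => rE DE.
  have m_gt0 : (0 < m)%N.
    case: m DE => // DE; move: rD; rewrite DE expr0 mulr1.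
    by move=> /(negP rE).
  have := Im_blowup (w := _) DE (or_introl r_gt0).
  set z := _ * _ => H.
  have [w [w1 _]] := exists_root_turn z m_gt0.
  have := H w; rewrite -/z w1 leNgt Re_mulJ_gt0// mulf_neq0// conjc_eq0.
  by move: rE; rewrite rootE.
move=> Nr rD; case: (ltrgt0P (Im rho)) => // h; exfalso.
- exact: (key rho).
- apply: (key rho^*%C).
  + by rewrite horner_conj conjc_eq0.
  + by move: rD; rewrite !rootE horner_conj conjc_eq0.
  + by case: rho h {Nr rD} => a b /=; rewrite oppr_gt0.
Qed.

(** At a real pole only directions into the upper half plane are allowed. They still include a bad
    one when the order is at least two; at order one the vertical direction yields the sign of the
    residue. *)
Lemma pole_simple (x : R) : D != 0 -> N.[x] != 0 -> root D x ->
  exists2 E, D = E * ('X - x%:P) & 0 < N.[x] * E.[x].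
Proof.
move=> D0 Nx rD.
have [m [E]] := multiplicity_XsubC D x; rewrite D0 /= => rE DE.
have m_gt0 : (0 < m)%N.
  by case: m DE => // DE; move: rD; rewrite DE expr0 mulr1 => /(negP rE).
have DEC : D^C = E^C * ('X - (toC x)%:P) ^+ m.
  by rewrite DE rmorphM rmorphXn rmorphB /= map_polyX map_polyC.
have H (w : C) : 0 < Im w ->
    Im (toC (N.[x] * E.[x]) * (w^*%C) ^+ m) <= 0.
  move=> w_gt0.
  have := Im_blowup DEC (or_intror (conj (erefl : Im (toC x) = 0) w_gt0)).
  by rewrite !horner_toC conjc_real -rmorphM.
set z := N.[x] * E.[x] in H *.
have z0 : z != 0 by rewrite mulf_neq0.
have zC0 : toC z != 0 by rewrite -(rmorph0 toC) (inj_eq (@complexI _)).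
have m1 : m = 1%N.
  apply/eqP; rewrite eqn_leq m_gt0 andbT leqNgt; apply/negP => m1.
  have [w [w1 [w2 /(_ m1)]]] := exists_root_turn (toC z) m_gt0.
  (* A real [w] is impossible: [w ^+ m] would be real, whereas [- 'i * z] is purely imaginary and
     nonzero. *)
  rewrite le_eqVlt => /orP[/eqP/esym w0|/H].
    move: w2; rewrite (Im0_toC w0) -rmorphXn => /(congr1 Im) /=.
    by move=> z_eq0; move/eqP: z0; apply; lra.
  by rewrite w1 leNgt Re_mulJ_gt0.
exists E; first by rewrite DE m1 expr1.
rewrite lt_neqAle eq_sym z0 /=.
have := H 'i%C ltr01; rewrite m1 expr1 /= -/z => ?; lra.
Qed.

End Poles.

(* If [deg P >= 2], or [deg P = 1] with positive slope, then [Im P] is unbounded above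
   along some ray of the upper half plane. *)
Lemma growth_affine (P : {poly R}) (K : R) :
    (forall s : C, 1 <= Im s -> Im P^C.[s] <= K) ->
  (size P <= 2)%N /\ P`_1 <= 0.
Proof.
move=> HP.
have key (w : C) : 0 < Im w -> (1 < size P)%N ->
    lead_coef P * Im (w ^+ (size P).-1) <= 0.
  move=> w_gt0 sP; rewrite leNgt; apply/negP => lw.
  (* [Im P] along the ray [w * t], as a real polynomial in [t]; its top coefficient decides the
     growth. *)
  pose q := \poly_(i < size P) (P`_i * Im (w ^+ i)).
  have qE t : q.[t] = Im P^C.[w * toC t].
    rewrite (horner_coef_wide _ (size_poly _ _)).
    rewrite horner_coef size_map_poly Im_sum; apply: eq_bigr => i _.
    rewrite coef_poly ltn_ord coef_map exprMn -rmorphXn mulrA ImMr.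
    by rewrite [toC _ * _]mulrC ImMr [_ * P`_i]mulrC.
  have sq : size q = size P by rewrite size_poly_eq// -lead_coefE gt_eqF.
  have lq : lead_coef q = lead_coef P * Im (w ^+ (size P).-1).
    by rewrite lead_coef_poly ?(ltn_trans _ sP)// -lead_coefE gt_eqF.
  have lqK : lead_coef (q - K%:P) = lead_coef q.
    rewrite lead_coefDl// size_polyN sq (leq_ltn_trans _ sP)//.
    exact: size_polyC_leq1.
  have := @poly_pinfty_gt_lc _ (q - K%:P); rewrite lqK lq => /(_ lw)[n].
  set t := Num.max n (Im w)^-1.
  move=> /(_ t ltac:(by rewrite le_max lexx)); rewrite hornerD hornerN hornerC qE.
  apply/negP; rewrite -ltNge (le_lt_trans _ lw)// subr_le0 HP//.
  rewrite ImMr -(mulfV (lt0r_neq0 w_gt0)) ler_pM2l// le_max.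
  by rewrite lexx orbT.
have sP2 : (size P <= 2)%N.
  rewrite leqNgt; apply/negP => sP.
  have m1 : (1 < (size P).-1)%N by case: (size P) sP => // -[].
  have l0 : lead_coef P != 0.
    by rewrite lead_coef_eq0 -size_poly_gt0 (ltn_trans _ sP).
  (* With [w ^+ m = 'i * lead_coef P], the quantity bounded by [key] becomes the square of the
     leading coefficient. *)
  have := key ((size P).-1.-root ('i%C * toC (lead_coef P))).
  have := Im_rootC_ge0 ('i%C * toC (lead_coef P)) m1; rewrite -complexIm ler0c.
  have := rootCK (ltn_trans (ltnSn _) m1) ('i%C * toC (lead_coef P)).
  move: (_.-root _) => w wm w_ge0 H.
  have w_gt0 : 0 < Im w.
    rewrite lt_neqAle eq_sym w_ge0 andbT; apply/eqP => w0.
    move: wm; rewrite (Im0_toC w0) -rmorphXn => /(congr1 Im) /= le0.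
    by move/eqP: l0; apply; lra.
  have := H w_gt0 (ltn_trans (ltnSn _) sP); rewrite wm /= mul0r add0r mul1r.
  rewrite leNgt => /negP; apply.
  by rewrite -expr2 lt_neqAle eq_sym sqrf_eq0 l0 sqr_ge0.
split=> //; move: sP2; rewrite leq_eqVlt => /orP[/eqP sP|sP]; last by rewrite nth_default.
by have := key 'i%C ltr01; rewrite lead_coefE sP /= mulr1 => /(_ isT).
Qed.

(** The numerator of the derivative: [(N / D)'] at [b] is [wron N D b / D.[b] ^+ 2]. *)
Definition wron (N D : {poly R}) (b : R) := N^`().[b] * D.[b] - N.[b] * D^`().[b].

(** * Partial fractions, monotonicity and convexity *)

Section PartialFractions.
Variables N D : {poly R}.
Hypothesis ND : forall s : C, 0 < Im s -> Im (N^C.[s] * (D^C.[s])^*%C) <= 0.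
Hypothesis coND : coprimep N D.
Hypothesis D0 : D != 0.

Lemma coprime_pole (x : R) : root D x -> N.[x] != 0.
Proof.
by move=> Dx; have := coprimep_root _ Dx; apply; rewrite coprimep_sym.
Qed.

(** Coprimality turns every root of [D] into a genuine pole, so [pole_real] makes [D] split over [R]
    and [pole_simple] excludes repeated roots. *)
Lemma split_poles : {xs : seq R | uniq xs & D = lead_coef D *: \prod_(x <- xs) ('X - x%:P)}.
Proof.
have [rs Drs] := closed_field_poly_normal D^C.
have re z : z \in rs -> Im z = 0.
  move=> zrs; have rz : root D^C z.
    by rewrite Drs rootZ ?lead_coef_eq0 ?map_poly_eq0// root_prod_XsubC.
  apply: (pole_real ND D0 _ rz).
  have cC : coprimep N^C D^C by rewrite coprimep_map.
  by have := coprimep_root _ rz; apply; rewrite coprimep_sym.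
have Dx : D = lead_coef D *: \prod_(x <- map Re rs) ('X - x%:P).
  apply: (@map_poly_inj _ _ toC); rewrite {1}Drs lead_coef_map.
  rewrite map_polyZ rmorph_prod /=; congr (_ *: _).
  rewrite big_map [LHS]big_seq [RHS]big_seq; apply: eq_bigr => z zrs.
  by rewrite {1}(Im0_toC (re z zrs)) rmorphB /= map_polyX map_polyC.
exists (map Re rs) => //.
move: (map Re rs) Dx => xs Dx.
apply: count_mem_uniq => x; case: (boolP (x \in xs)) => xxs; last exact/count_memPn.
have /permP -> := perm_to_rem xxs; rewrite /= eqxx.
suff /count_memPn -> : x \notin rem x xs by [].
have rx : root D x by rewrite Dx rootZ ?lead_coef_eq0// root_prod_XsubC.
have [E DE NE] := pole_simple ND D0 (coprime_pole rx) rx.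
apply/negP => xr; move: NE.
suff -> : E.[x] = 0 by rewrite mulr0 ltxx.
apply/eqP; rewrite -/(root E x).
have -> : E = lead_coef D *: \prod_(y <- rem x xs) ('X - y%:P).
  apply: (@mulIf _ ('X - x%:P)); first by rewrite polyXsubC_eq0.
  by rewrite -DE {1}Dx (perm_big _ (perm_to_rem xxs)) big_cons /= -scalerAl mulrC.
by rewrite rootZ ?lead_coef_eq0// root_prod_XsubC.
Qed.

Lemma partial_fractions : exists (P : {poly R}) (xs : seq R) (c : R -> R) (Q : R -> {poly R}),
  [/\ N = P * D + \sum_(x <- xs) c x *: Q x,
      forall x, x \in xs -> [/\ 0 <= c x, root D x & D = Q x * ('X - x%:P)],
      (size P <= 2)%N & P`_1 <= 0].
Proof.
have [xs uxs Dxs] := split_poles.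
have rxs x : (x \in xs) = root D x.
  by rewrite Dxs rootZ ?lead_coef_eq0// root_prod_XsubC.
pose Q x := D %/ ('X - x%:P).
have DQ x : x \in xs -> D = Q x * ('X - x%:P) /\ 0 < N.[x] * (Q x).[x].
  rewrite rxs => rx; have [E DE NE] := pole_simple ND D0 (coprime_pole rx) rx.
  suff -> : Q x = E by [].
  by rewrite /Q DE mulpK// polyXsubC_eq0.
(* The residue of [N / D] at [x]. *)
pose c x := N.[x] / (Q x).[x].
have c_ge0 x : x \in xs -> 0 <= c x.
  move=> /DQ[_ h]; have E0 : (Q x).[x] != 0.
    by apply/eqP => E0; rewrite E0 mulr0 ltxx in h.
  have -> : c x = N.[x] * (Q x).[x] / (Q x).[x] ^+ 2 by rewrite /c; field.
  by rewrite divr_ge0 ?sqr_ge0 ?ltW.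
have /dvdpP[P NP] : D %| N - \sum_(x <- xs) c x *: Q x.
  rewrite {1}Dxs dvdpZl ?lead_coef_eq0//; apply: uniq_roots_dvdp.
    apply/allP => y yxs; rewrite rootE hornerD hornerN horner_sum.
    rewrite (bigD1_seq y)//= big_seq_cond big1 ?addr0; last first.
      move=> x /andP[xxs xy]; rewrite hornerZ.
      have [Dx _] := DQ x xxs.
      have : D.[y] = 0 by apply/eqP; rewrite -/(root _ _) -rxs.
      rewrite Dx hornerM hornerXsubC => /eqP; rewrite mulf_eq0 subr_eq0 [y == x]eq_sym (negbTE xy) orbF.
      by move=> /eqP ->; rewrite mulr0.
    have [_] := DQ y yxs; rewrite hornerZ /c => h.
    rewrite divfK ?subrr//; apply/eqP => h0; move: h; by rewrite h0 mulr0 ltxx.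
  by rewrite uniq_rootsE.
have NE : N = P * D + \sum_(x <- xs) c x *: Q x by rewrite -NP subrK.
(* On [Im s >= 1] each term [c x / (s - x)] has imaginary part at least [- c x]. As the whole
   function has nonpositive imaginary part, that of [P] is at most the sum of the residues, and
   [growth_affine] applies. *)
have [P2 P1] : (size P <= 2)%N /\ P`_1 <= 0.
  apply: (growth_affine (K := \sum_(x <- xs) c x)) => s s1.
  have s_gt0 : 0 < Im s by rewrite (lt_le_trans ltr01).
  have := ND s_gt0.
  rewrite NE !rmorphD rmorphM /= rmorph_sum /= hornerD hornerM horner_sum.
  set d := D^C.[s].
  have d_gt0 : 0 < Re (d * d^*%C).
    apply: Re_mulJ_gt0; apply/eqP => d0.
    have rs : root D^C s by apply/eqP.
    have cC : coprimep D^C N^C by rewrite coprimep_map coprimep_sym.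
    have := pole_real ND D0 (coprimep_root cC rs) rs.
    by move=> sI; rewrite sI ltxx in s_gt0.
  rewrite mulrDl mulr_suml ImD Im_sum -mulrA.
  have -> : d * d^*%C = toC (Re (d * d^*%C)).
    by apply: Im0_toC; case: (d) => x y /=; ring.
  rewrite ImMr.
  have : - (\sum_(x <- xs) c x) * Re (d * d^*%C) <=
      \sum_(i <- xs) Im ((c i *: Q i)^C.[s] * d^*%C).
    rewrite mulNr mulr_suml -sumrN big_seq [leRHS]big_seq.
    apply: ler_sum => x xxs; have [Dx _] := DQ x xxs.
    have -> : d = (Q x)^C.[s] * (s - toC x).
      by rewrite /d {1}Dx rmorphM rmorphB /= map_polyX map_polyC /= !hornerE.
    rewrite map_polyZ hornerZ.
    move: (c_ge0 x xxs) s1; move: ((Q x)^C.[s]) (c x) => [q1 q2] e; move: (s) => [s1 s2] /= => e_ge0 ss1.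
    rewrite -subr_ge0.
    set u := (X in 0 <= X).
    have -> : u = e * (q1 ^+ 2 + q2 ^+ 2) * ((s1 - x) ^+ 2 + s2 ^+ 2 - s2) by rewrite /u; ring.
    apply: mulr_ge0; [by rewrite mulr_ge0// addr_ge0 ?sqr_ge0//|].
    have := sqr_ge0 (s1 - x); move: ((s1 - x) ^+ 2) => y y0. nra.
  move: (\sum_(_ <- _) Im _) => S h1 h2.
  by rewrite -(ler_pM2r d_gt0); lra.
exists P, xs, c, Q; split=> // x xxs; have [? _] := DQ x xxs; split=> //; first exact: c_ge0.
by rewrite -rxs.
Qed.

End PartialFractions.

(** All poles lie left of [a], so each [c / (x - y)] is decreasing and convex on [[a, b]], and the
    affine part is decreasing. The second conclusion is the tangent inequality of a convex function
    at [b]. *)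
Lemma nevanlinna_convex_coprime (N D : {poly R}) (a b : R) :
    (forall s : C, 0 < Im s -> Im (N^C.[s] * (D^C.[s])^*%C) <= 0) ->
    coprimep N D -> (forall x, a <= x -> D.[x] != 0) -> a <= b ->
  wron N D b <= 0 /\
  N.[b] / D.[b] - N.[a] / D.[a] <= (b - a) * (wron N D b / D.[b] ^+ 2).
Proof.
move=> ND coND Da ab.
have D0 : D != 0 by apply/eqP => D0; have := Da a (lexx a); rewrite D0 horner0 eqxx.
have [P [xs [c [Q [NE Hxs P2 P1]]]]] := partial_fractions ND coND D0.
have xa x : x \in xs -> x < a.
  move=> /Hxs[_ rx _]; rewrite ltNge; apply/negP => /Da.
  by rewrite -[_ == 0]/(root D x) rx.
have wE : wron N D b = P`_1 * D.[b] ^+ 2 - \sum_(x <- xs) c x * (Q x).[b] ^+ 2.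
  have P'b : P^`().[b] = P`_1.
    rewrite (horner_coef_wide (n := 1)).
      by rewrite big_ord1 expr0 mulr1 coef_deriv mulr1n.
    by rewrite (leq_trans (size_poly _ _))//; case: (size P) P2 => [|[|[]]].
  rewrite /wron NE derivD derivM !hornerD !hornerM P'b mulrDl.
  have -> : (\sum_(x <- xs) c x *: Q x)^`().[b] * D.[b] =
     (\sum_(x <- xs) c x *: Q x).[b] * D^`().[b] - \sum_(x <- xs) c x * (Q x).[b] ^+ 2.
    rewrite raddf_sum !horner_sum !mulr_suml -sumrB big_seq [RHS]big_seq.
    apply: eq_bigr => x /Hxs[_ _ Dx].
    rewrite /= derivZ !hornerZ [D]Dx derivM derivXsubC mulr1 hornerD !hornerM hornerXsubC; ring.
  ring.
split.
  rewrite wE subr_le0 (@le_trans _ _ 0)//; first by rewrite mulr_le0_ge0 ?sqr_ge0.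
  by rewrite big_seq sumr_ge0// => x /Hxs[c0 _ _]; rewrite mulr_ge0 ?sqr_ge0.
have PE x : P.[x] = P`_0 + P`_1 * x.
  rewrite (horner_coef_wide _ P2) big_ord_recl big_ord1 /=.
  by rewrite expr0 mulr1 expr1.
have FE x : a <= x -> N.[x] / D.[x] = P.[x] + \sum_(y <- xs) c y / (x - y).
  move=> ax; have Dx := Da x ax; rewrite {1}NE hornerD hornerM horner_sum mulrDl mulfK//.
  congr (_ + _); rewrite mulr_suml big_seq [RHS]big_seq; apply: eq_bigr => y yxs.
  have [_ _ Dy] := Hxs y yxs; have ya := xa y yxs.
  move: Dx; rewrite hornerZ Dy hornerM hornerXsubC mulf_eq0 negb_or => /andP[h1 h2].
  by field; rewrite h1 h2.
rewrite (FE b ab) (FE a (lexx a)) !PE.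
have -> : wron N D b / D.[b] ^+ 2 = P`_1 - \sum_(x <- xs) c x / (b - x) ^+ 2.
  have Db := Da b ab.
  rewrite wE mulrBl mulfK ?expf_neq0//; congr (_ - _).
  rewrite mulr_suml big_seq [RHS]big_seq; apply: eq_bigr => y yxs.
  have [_ _ Dy] := Hxs y yxs.
  move: Db; rewrite Dy hornerM hornerXsubC mulf_eq0 negb_or => /andP[h1 h2].
  by field; rewrite h1 h2.
have : \sum_(y <- xs) c y / (b - y) - \sum_(y <- xs) c y / (a - y) <=
   - ((b - a) * \sum_(x <- xs) c x / (b - x) ^+ 2).
  rewrite -sumrB -mulrN -sumrN mulr_sumr big_seq [leRHS]big_seq.
  apply: ler_sum => y yxs; have [c0 _ _] := Hxs y yxs; have ya := xa y yxs.
  have by_gt0 : 0 < b - y by lra.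
  have ay_gt0 : 0 < a - y by lra.
  rewrite -subr_ge0.
  set u := (X in 0 <= X).
  have -> : u = c y * (b - a) ^+ 2 / ((b - y) ^+ 2 * (a - y)).
    by rewrite /u; field; rewrite !lt0r_neq0.
  by apply: divr_ge0; apply: mulr_ge0 => //; rewrite ?sqr_ge0 ?ltW.
move: (\sum_(_ <- _) _) (\sum_(_ <- _) _) (\sum_(_ <- _) _) => S1 S2 S3; lra.
Qed.

Lemma avoid_seq (s : seq R) : exists2 e0 : R, 0 < e0 & forall e, 0 < e -> e < e0 -> e \notin s.
Proof.
elim: s => [|x s [e0 e0_gt0 He0]]; first by exists 1.
exists (if 0 < x then Num.min x e0 else e0).
  by case: ifP => // x0; rewrite lt_min x0.
move=> e e_gt0 le; rewrite inE negb_or He0//; last first.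
  by move: le; case: ifP => // _; rewrite lt_min => /andP[].
rewrite andbT; apply/eqP => ex; move: le; rewrite -ex e_gt0 lt_min ltxx.
by [].
Qed.

Theorem nevanlinna_convex (N D : {poly R}) (a b : R) :
    (forall s : C, 0 < Im s -> Im (N^C.[s] * (D^C.[s])^*%C) <= 0) ->
    (forall x, a <= x -> D.[x] != 0) -> a <= b ->
  wron N D b <= 0 /\
  N.[b] / D.[b] - N.[a] / D.[a] <= (b - a) * (wron N D b / D.[b] ^+ 2).
Proof.
move=> ND Da ab.
have D0 : D != 0 by apply/eqP => D0; have := Da a (lexx a); rewrite D0 horner0 eqxx.
set g := gcdp N D; set N1 := N %/ g; set D1 := D %/ g.
have NE : N = N1 * g by rewrite divpK ?dvdp_gcdl.
have DE : D = D1 * g by rewrite divpK ?dvdp_gcdr.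
have co1 : coprimep N1 D1 by apply: coprimep_div_gcd; rewrite D0 orbT.
have gD1 x : a <= x -> g.[x] != 0 /\ D1.[x] != 0.
  by move=> /Da; rewrite {1}DE hornerM mulf_eq0 negb_or => /andP[].
(* The common factor contributes [|g| ^+ 2], which cannot be cancelled at a zero of [g]. Each [s] is
   therefore approached vertically through points off the roots of [g]; [Im_blowup_near] with
   exponent [0] is the plain limit. *)
have ND1 (s : C) : 0 < Im s -> Im (N1^C.[s] * (D1^C.[s])^*%C) <= 0.
  move=> s_gt0; have := @Im_blowup_near N1^C D1^C s 'i%C 0 D1^C.
  rewrite !expr0 !mulr1; apply=> //.
  have [rs grs] := closed_field_poly_normal g^C.
  have [e0 e0_gt0 He0] := avoid_seq [seq Im z - Im s | z <- rs].
  exists e0 => // e e_gt0 ee0; set s' := s + _.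
  have ImS : Im s' = Im s + e by rewrite /s' ImD ImMr /= mul1r.
  have gs' : g^C.[s'] != 0.
    apply/eqP => /eqP; rewrite -[_ == 0]/(root g^C s') grs rootZ; last first.
      by rewrite lead_coef_eq0 map_poly_eq0 gcdp_eq0 negb_and D0 orbT.
    rewrite root_prod_XsubC => s'rs.
    have /negP := He0 e e_gt0 ee0; apply; apply/mapP; exists s' => //.
    by rewrite ImS; ring.
  have := ND s'; rewrite ImS addr_gt0// => /(_ isT).
  rewrite {1}NE {1}DE !rmorphM /= !hornerM rmorphM /= mulrACA.
  have -> : g^C.[s'] * (g^C.[s'])^*%C = toC (Re (g^C.[s'] * (g^C.[s'])^*%C)).
    by apply: Im0_toC; case: (g^C.[s']) => x y /=; ring.
  by rewrite ImMr pmulr_lle0// Re_mulJ_gt0.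
have [w1 w2] := nevanlinna_convex_coprime ND1 co1 (fun x ax => proj2 (gD1 x ax)) ab.
have wE : wron N D b = wron N1 D1 b * g.[b] ^+ 2.
  rewrite /wron {1 2}NE {1 2}DE !derivM !hornerD !hornerM; ring.
have [gb Db] := gD1 b ab; have [ga Da1] := gD1 a (lexx a).
split; first by rewrite wE mulr_le0_ge0 ?sqr_ge0.
rewrite wE {1 2}NE {1 2 3}DE !hornerM.
have -> : N1.[b] * g.[b] / (D1.[b] * g.[b]) = N1.[b] / D1.[b] by field; rewrite gb Db.
have -> : N1.[a] * g.[a] / (D1.[a] * g.[a]) = N1.[a] / D1.[a] by field; rewrite ga Da1.
have -> : wron N1 D1 b * g.[b] ^+ 2 / (D1.[b] * g.[b]) ^+ 2 = wron N1 D1 b / D1.[b] ^+ 2.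
  by field; rewrite gb Db.
exact: w2.
Qed.


Lemma poly_eq0_horner p : (forall x, p.[x] = 0) -> p = 0.
Proof.
move=> p0; apply/eqP; rewrite -lead_coef_eq0; apply/eqP.
have key q : (forall x, q.[x] = 0) -> lead_coef q <= 0.
  move=> q0; rewrite leNgt; apply/negP => lq.
  have [m /(_ m (lexx m))] := poly_pinfty_gt_lc lq.
  by rewrite q0 leNgt lq.
apply/eqP; rewrite eq_le key// -oppr_le0 -lead_coefN key// => x.
by rewrite hornerN p0 oppr0.
Qed.

Definition Re_poly P : {poly R} := \poly_(i < size P) Re P`_i.

Lemma Re_polyK P : (forall k, Im P`_k = 0) -> (Re_poly P)^C = P.
Proof.
move=> P0; apply/polyP => k; rewrite coef_map coef_poly.
by case: ltnP => h; [rewrite /= -(Im0_toC (P0 k))|rewrite nth_default].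
Qed.

Lemma Re_polyK_horner P : (forall x : R, Im P.[toC x] = 0) -> (Re_poly P)^C = P.
Proof.
move=> P0; apply: Re_polyK => k; rewrite -coef_Im_poly.
by rewrite (@poly_eq0_horner (Im_poly P)) ?coef0// => x; rewrite horner_Im_poly.
Qed.

Lemma seq_has_max (s : seq R) : s != [::] -> exists2 m, m \in s & forall y, y \in s -> y <= m.
Proof.
elim: s => // x s IH _; case: (eqVneq s [::]) => [->|/IH[m ms Hm]].
  by exists x; [rewrite inE|move=> y; rewrite inE => /eqP ->].
case: (leP m x) => mx.
  exists x; first by rewrite inE eqxx.
  by move=> y; rewrite inE => /predU1P[->//|/Hm ym]; rewrite (le_trans ym).
exists m; first by rewrite inE ms orbT.
by move=> y; rewrite inE => /predU1P[->|/Hm//]; rewrite ltW.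
Qed.

Lemma last_root (p : {poly R}) (x0 : R) : 0 < lead_coef p -> p.[x0] <= 0 ->
  exists rho, [/\ x0 <= rho, p.[rho] = 0 & forall x, rho < x -> 0 < p.[x]].
Proof.
move=> lp px0; have [m Hm] := poly_pinfty_gt_lc lp.
have p0 : p != 0 by rewrite -lead_coef_eq0 gt_eqF.
have ivt x : p.[x] <= 0 -> exists2 y, x <= y & root p y.
  move=> px; have := @polyrcf.poly_ivt _ p x (Num.max m x).
  rewrite le_max lexx orbT mulr_le0_ge0//; last first.
    by apply/ltW/(lt_le_trans lp)/Hm; rewrite le_max lexx.
  by case=> // y /itvP /= Hy ry; exists y => //; rewrite Hy.
pose s := [seq x <- rootsR p | x0 <= x].
have in_s x : (x \in s) = (x0 <= x) && root p x.
  by rewrite mem_filter -(roots_on_rootsR p0) in_itv.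
have [|rho] := @seq_has_max s.
  by have [y x0y ry] := ivt _ px0; apply/eqP => s0; have := in_s y; rewrite s0 x0y ry.
rewrite in_s => /andP[x0r /eqP pr] Hr; exists rho; split=> // x rx.
rewrite ltNge; apply/negP => /ivt[y xy ry].
have := Hr y; rewrite in_s ry andbT => /(_ ltac:(lra)) yr; lra.
Qed.

(* [N / D] decreases to [0] at infinity. *)
Lemma nevanlinna_ge0 (N D : {poly R}) (a : R) :
    (forall s : C, 0 < Im s -> Im (N^C.[s] * (D^C.[s])^*%C) <= 0) ->
    (forall x, a <= x -> 0 < D.[x]) -> (size N < size D)%N -> 0 < lead_coef D ->
  0 <= N.[a].
Proof.
move=> ND Da sND lD; rewrite leNgt; apply/negP => Na.
(* If the ratio were [- k < 0] at [a], it would stay below [- k], so [k D + N] would be nonpositive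
   from [a] on, although its leading coefficient is that of [k D]. *)
pose k := - (N.[a] / D.[a]).
have Da_gt0 := Da a (lexx a).
have k_gt0 : 0 < k by rewrite /k oppr_gt0 pmulr_llt0 ?invr_gt0.
have lk : lead_coef (k *: D + N) = k * lead_coef D.
  by rewrite lead_coefDl ?lead_coefZ// size_scale ?gt_eqF.
have := @poly_pinfty_gt_lc _ (k *: D + N); rewrite lk => /(_ (mulr_gt0 k_gt0 lD))[m].
set b := Num.max m a => /(_ b); rewrite le_max lexx => /(_ isT).
have ab : a <= b by rewrite le_max lexx orbT.
have [w_le0 le] := nevanlinna_convex ND (fun x ax => lt0r_neq0 (Da x ax)) ab.
have Db := Da b ab.
have : N.[b] / D.[b] <= - k.
  rewrite /k opprK; move: le; rewrite lerBlDr => /le_trans; apply.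
  rewrite gerDr mulr_ge0_le0// ?subr_ge0// mulr_le0_ge0// invr_ge0 sqr_ge0//.
rewrite ler_pdivrMr// hornerD hornerZ => h1 h2.
by have := mulr_gt0 k_gt0 lD; lra.
Qed.

End Nevanlinna.

(** * Real stable multi-affine polynomials and the barrier argument *)

Section MultiAffine.
Variables (R : rcfType) (n r : nat).
Local Notation C := R[i].
Local Notation toC := (real_complex R).
Local Notation "p ^C" := (map_poly toC p) (at level 1, format "p ^C").
Local Notation Re := (@complex.Re R).
Local Notation Im := (@complex.Im R).
Local Notation V := 'M[C]_(n, r).
Local Notation e i j := (delta_mx i j : V).

Section Operators.
Variable W : lmodType C.
Implicit Types (p : V -> W) (v : V).

(* For a multi-affine polynomial this difference is the partial derivative, so no
   formal multivariate polynomials are needed. *)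
Definition pdiff (i : 'I_n) (j : 'I_r) p v := p (v + e i j) - p v.

Definition mean_diff (i : 'I_n) p v := (r%:R : C)^-1 *: \sum_j pdiff i j p v.

(** The value space is [{poly C}] for the polynomials themselves and [C^o] for their evaluation at a
    fixed point. *)
Definition multiaffine p := forall i j (s : C) v,
  p (v + s *: e i j) = p v + s *: pdiff i j p v.

Lemma pdiffC i j i' j' p v : pdiff i j (pdiff i' j' p) v = pdiff i' j' (pdiff i j p) v.
Proof.
rewrite /pdiff [v + e i j + e i' j']addrAC !opprB addrACA [RHS]addrACA.
by congr (_ + _); rewrite addrC.
Qed.

Lemma pdiff_same p i j c v : multiaffine p -> pdiff i j p (v + c *: e i j) = pdiff i j p v.
Proof.
move=> ap; rewrite {1}/pdiff -addrA -{2}[e i j]scale1r -scalerDl !ap.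
by rewrite opprD addrACA subrr add0r -scalerBl addrAC subrr add0r scale1r.
Qed.

Lemma multiaffine_pdiff p i j : multiaffine p -> multiaffine (pdiff i j p).
Proof.
move=> ap i' j' s v; rewrite pdiffC {1}/pdiff [v + _ + e i j]addrAC !ap.
by rewrite opprD addrACA -scalerBr.
Qed.

Lemma pdiffB p q i j v : pdiff i j (fun v => p v - q v) v = pdiff i j p v - pdiff i j q v.
Proof. by rewrite /pdiff !opprB addrACA [RHS]addrACA; congr (_ + _); rewrite addrC. Qed.

Lemma pdiffZ p c i j v : pdiff i j (fun v => c *: p v) v = c *: pdiff i j p v.
Proof. by rewrite /pdiff scalerBr. Qed.

Lemma pdiff_sum (I : finType) (F : I -> V -> W) i j v :
  pdiff i j (fun v => \sum_k F k v) v = \sum_k pdiff i j (F k) v.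
Proof. by rewrite /pdiff sumrB. Qed.

Lemma multiaffineB p q : multiaffine p -> multiaffine q -> multiaffine (fun v => p v - q v).
Proof.
by move=> ap aq i j s v; rewrite ap aq pdiffB opprD addrACA -scalerBr.
Qed.

Lemma multiaffine_mean i p : multiaffine p -> multiaffine (mean_diff i p).
Proof.
move=> ap k j s v; rewrite /mean_diff pdiffZ pdiff_sum.
under eq_bigr do rewrite multiaffine_pdiff//.
by rewrite big_split /= scalerDr -scaler_sumr !scalerA [s * _]mulrC.
Qed.

Lemma mean_diffC i k p v : mean_diff i (mean_diff k p) v = mean_diff k (mean_diff i p) v.
Proof.
rewrite /mean_diff; under eq_bigr do rewrite pdiffZ pdiff_sum.
under [in RHS]eq_bigr do rewrite pdiffZ pdiff_sum.
rewrite -!scaler_sumr exchange_big /=; congr (_ *: (_ *: _)).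
by apply: eq_bigr => j _; apply: eq_bigr => j' _; rewrite pdiffC.
Qed.

(** Equal weight on all colours of the index [i]; for multi-affine functions [mean_diff i] is the
    derivative in this direction. *)
Definition dir i : V := \sum_j (r%:R : C)^-1 *: e i j.

End Operators.

Definition real_pt (v : V) := forall i j, Im (v i j) = 0.
Definition upper_pt (v : V) := forall i j, 0 <= Im (v i j).

Lemma toC_nat_inv (k : nat) : (k%:R : C)^-1 = toC k%:R^-1.
Proof. by rewrite fmorphV rmorph_nat. Qed.

Lemma dirE i k j : dir i k j = toC (r%:R^-1 *+ (k == i)).
Proof.
rewrite summxE (bigD1 j)//= big1 ?addr0; last first.
  by move=> j' jj'; rewrite !mxE [j == j']eq_sym (negbTE jj') andbF mulr0.
by rewrite !mxE eqxx andbT toC_nat_inv; case: (k == i); rewrite ?mulr1 ?mulr0 ?rmorph0.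
Qed.

Section Line.
Variable g : V -> C^o.
Hypothesis ag : multiaffine g.

(** The coordinates of the row [i] are moved one at a time: splitting off colour [j] writes the
    restriction as [q1 + r^-1 X q2], where [q2] belongs to [pdiff i j f]. *)
Lemma line_polyC i (y : V) : exists q : {poly C}, forall s,
  q.[s] = g (y + s *: dir i) /\ q^`().[s] = mean_diff i g (y + s *: dir i).
Proof.
suff H (js : seq 'I_r) (f : V -> C^o) : multiaffine f ->
    exists q : {poly C}, forall s,
    q.[s] = f (y + s *: \sum_(j <- js) (r%:R : C)^-1 *: e i j) /\
    q^`().[s] = (r%:R : C)^-1 *
      \sum_(j <- js) pdiff i j f (y + s *: \sum_(j <- js) (r%:R : C)^-1 *: e i j).
  by have [q Hq] := H (index_enum 'I_r) g ag; exists q.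
elim: js f => [|j js IH] f af.
  by exists (f y)%:P => s; rewrite !big_nil scaler0 addr0 hornerC derivC horner0 mulr0.
have [q1 H1] := IH f af; have [q2 H2] := IH _ (multiaffine_pdiff i j af).
exists (q1 + (r%:R)^-1 *: ('X * q2)) => s; have [h1 h1'] := H1 s; have [h2 h2'] := H2 s.
set E := \sum_(j <- js) _ in h1 h1' h2 h2' *.
have yE : y + s *: \sum_(j <- j :: js) (r%:R : C)^-1 *: e i j = y + s *: E + (s * (r%:R)^-1) *: e i j.
  by rewrite big_cons scalerDr scalerA [_ + s *: E]addrC addrA.
rewrite !yE; split.
  rewrite hornerD hornerZ hornerM hornerX h1 h2 af; congr (_ + _).
  by rewrite mulrA [_ * s]mulrC.
rewrite derivD derivZ derivM derivX mul1r !hornerD hornerZ hornerD hornerM hornerX h1' h2' h2.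
rewrite big_cons pdiff_same// mulrDr.
under [in RHS]eq_bigr do rewrite (multiaffine_pdiff _ _ af) pdiffC.
rewrite [X in _ = _ * (_ + X)]big_split /=.
rewrite -[X in _ = _ * (_ + (_ + X))]scaler_sumr.
rewrite /GRing.scale /=; ring.
Qed.

Hypothesis rg : forall v, real_pt v -> Im (g v) = 0.

Lemma line_poly i (y : V) : real_pt y -> exists q : {poly R}, forall s,
  q^C.[s] = g (y + s *: dir i) /\ q^`()^C.[s] = mean_diff i g (y + s *: dir i).
Proof.
move=> ry; have [q Hq] := line_polyC i y.
have qE : (Re_poly q)^C = q.
  apply: Re_polyK_horner => x; rewrite (proj1 (Hq _)); apply: rg => k j.
  by rewrite !mxE ImD ry add0r dirE [_ * _]mulrC ImMr mul0r.
exists (Re_poly q) => s; split; first by rewrite qE (proj1 (Hq _)).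
by rewrite -deriv_map qE (proj2 (Hq _)).
Qed.

End Line.

Lemma real_pt_shift v i j (s : C) : Im s = 0 -> real_pt v -> real_pt (v + s *: e i j).
Proof.
move=> s0 rv k l; rewrite !mxE ImD rv add0r (Im0_toC s0).
by case: (_ && _); rewrite ?mulr1 ?mulr0.
Qed.

Lemma upper_pt_shift v i j (s : C) : 0 <= Im s -> upper_pt v -> upper_pt (v + s *: e i j).
Proof.
move=> s0 uv k l; rewrite !mxE ImD addr_ge0//.
by case: (_ && _); rewrite ?mulr1 ?mulr0.
Qed.

(** Stability is joint in [x] and the matrix entries. The entries range over the closed half plane,
    so that real [v] are included; [rs_monic] says that every [p v] is monic of degree [M]. *)
Record real_stable (M : nat) (p : V -> {poly C}) : Prop := RealStable {
  rs_affine : multiaffine p;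
  rs_real : forall v, real_pt v -> forall k, Im (p v)`_k = 0;
  rs_neq0 : forall v x, upper_pt v -> 0 < Im x -> (p v).[x] != 0;
  rs_monic : forall v, (size (p v - 'X^M)%R <= M)%N }.

(** * Stability under averaging, and the choice of one colour *)

Section Stable.
Variables (M : nat) (p : V -> {poly C}).
Hypothesis rsp : real_stable M p.

(** Raising the entry [(i, j)] by [s] with [Im s >= 0] keeps [p + s * pdiff] away from zero, so the
    root [s = - p / pdiff] lies in the open lower half plane. *)
Lemma Im_pdiff v x i j : upper_pt v -> 0 < Im x ->
  (pdiff i j p v).[x] = 0 \/ Im ((pdiff i j p v).[x] * ((p v).[x])^*%C) < 0.
Proof.
move=> uv x_gt0; case: (eqVneq (pdiff i j p v).[x] 0) => [->|b0]; [by left|right].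
set a := (p v).[x]; set b := (pdiff i j p v).[x] in b0 *.
have s_lt0 : Im (- a / b) < 0.
  rewrite ltNge; apply/negP => s_ge0.
  have := rs_neq0 rsp (upper_pt_shift i j s_ge0 uv) x_gt0.
  by rewrite (rs_affine rsp) hornerD hornerZ -/a -/b mulfVK// subrr eqxx.
have aE : a = - ((- a / b) * b) by rewrite mulfVK// opprK.
have b_gt0 := Re_mulJ_gt0 b0.
rewrite {1}aE; move: (- a / b) s_lt0 => [s1 s2] /= s_lt0.
case: (b) b_gt0 => b1 b2 /= b_gt0.
set u := (X in X < 0); have -> : u = s2 * (b1 * b1 - b2 * - b2) by rewrite /u; ring.
by rewrite nmulr_rlt0.
Qed.

Lemma Im_pdiff_le0 v x i j : upper_pt v -> 0 < Im x ->
  Im ((pdiff i j p v).[x] * ((p v).[x])^*%C) <= 0.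
Proof. by move=> uv x0; have [->|/ltW//] := Im_pdiff i j uv x0; rewrite mul0r. Qed.

Lemma horner_mean_diff i v (x : C) :
  (mean_diff i p v).[x] = (r%:R)^-1 * \sum_j (pdiff i j p v).[x].
Proof. by rewrite /mean_diff hornerZ horner_sum. Qed.

Lemma Im_mean_diff_le0 v x i : upper_pt v -> 0 < Im x ->
  Im ((mean_diff i p v).[x] * ((p v).[x])^*%C) <= 0.
Proof.
move=> uv x0; rewrite horner_mean_diff toC_nat_inv -mulrA mulrC ImMr.
rewrite mulr_le0_ge0 ?invr_ge0// mulr_suml Im_sum.
by apply: sumr_le0 => j _; apply: Im_pdiff_le0.
Qed.

Lemma size_pdiff v i j : (size (pdiff i j p v) <= M)%N.
Proof.
have -> : pdiff i j p v = (p (v + e i j) - 'X^M) - (p v - 'X^M).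
  by rewrite /pdiff opprB addrA subrK.
by rewrite (leq_trans (size_polyD _ _))// geq_max size_polyN !(rs_monic rsp).
Qed.

Lemma size_mean_diff v i : (size (mean_diff i p v) <= M)%N.
Proof.
rewrite (leq_trans (size_scale_leq _ _))// (leq_trans (size_sum _ _ _))//.
by apply/bigmax_leqP => j _; apply: size_pdiff.
Qed.

Lemma Im_coef_pdiff v i j k : real_pt v -> Im (pdiff i j p v)`_k = 0.
Proof.
move=> rv; rewrite coefB ImB !(rs_real rsp) ?subrr// -[e i j]scale1r.
exact: real_pt_shift.
Qed.

Lemma real_stable_step i : (0 < r)%N -> real_stable M (fun v => p v - mean_diff i p v).
Proof.
move=> r_gt0; split.
- by apply: multiaffineB; [|apply: multiaffine_mean]; apply: (rs_affine rsp).
- move=> v rv k; rewrite coefB ImB (rs_real rsp)// sub0r; apply/eqP; rewrite oppr_eq0.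
  rewrite coefZ toC_nat_inv mulrC ImMr coef_sum Im_sum big1 ?mul0r// => j _.
  exact: Im_coef_pdiff.
- move=> v x uv x0; apply/eqP; rewrite hornerD hornerN horner_mean_diff => /eqP.
  rewrite subr_eq0 => /eqP pE.
  have S0 : \sum_j Im ((pdiff i j p v).[x] * ((p v).[x])^*%C) = 0.
    have := congr1 (fun z => Im (r%:R * z * ((p v).[x])^*%C)) pE.
    rewrite mulrA mulfV ?pnatr_eq0 -?lt0n// mul1r mulr_suml Im_sum => <-.
    rewrite -(rmorph_nat toC) -mulrA mulrC ImMr.
    by case: (p v).[x] => a b /=; ring.
  have H j : (pdiff i j p v).[x] = 0.
    have [//|] := Im_pdiff i j uv x0.
    have /eqP := S0; rewrite (bigD1 j)//= addr_eq0 => /eqP ->.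
    rewrite oppr_lt0 ltNge sumr_le0// => j' _; exact: Im_pdiff_le0.
  have := rs_neq0 rsp uv x0; rewrite pE big1 ?mulr0 ?eqxx//.
- move=> v; rewrite addrAC (leq_trans (size_polyD _ _))// geq_max size_polyN.
  by rewrite (rs_monic rsp) size_mean_diff.
Qed.

Definition real_of v : {poly R} := Re_poly (p v).

Lemma real_ofE v : real_pt v -> (real_of v)^C = p v.
Proof. by move=> rv; apply: Re_polyK; apply: (rs_real rsp). Qed.

Lemma lead_real_of v : real_pt v -> size (real_of v) = M.+1 /\ lead_coef (real_of v) = 1.
Proof.
move=> rv; have <- : size (p v) = size (real_of v).
  by rewrite -(real_ofE rv) size_map_poly.
have pE : p v = 'X^M + (p v - 'X^M) by rewrite addrC subrK.
have sz : (size (p v - 'X^M)%R < size ('X^M : {poly C}))%N.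
  by rewrite size_polyXn ltnS (rs_monic rsp).
split; first by rewrite pE size_polyDl// size_polyXn.
apply: (@complexI R); rewrite -lead_coef_map real_ofE// pE lead_coefDl//.
by rewrite lead_coefXn rmorph1.
Qed.

Lemma horner_shift_back v i j x : (p (v - e i j)).[x] = (p v).[x] - (pdiff i j p v).[x].
Proof.
by rewrite -[- e i j]scaleN1r (rs_affine rsp) hornerD hornerZ mulN1r.
Qed.

(** With [a] for [p v] and [N j] for the partial derivative, colour [j] gives [a - N j]. The average
    of the ratios [N j / a] is below [1] at [lam], so one of them is; being decreasing, it stays
    below [1] from [lam] on. *)
Theorem select_colour v i (lam : R) : (0 < r)%N -> real_pt v ->
    (forall x, lam <= x -> 0 < Re (p v - mean_diff i p v).[toC x]) ->
  exists j, forall x, lam <= x -> 0 < Re (p (v - e i j)).[toC x].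
Proof.
move=> r_gt0 rv Hx.
set a := real_of v; have [sa la] := lead_real_of rv; rewrite -/a in sa la.
have aE x : (p v).[toC x] = toC a.[x] by rewrite -horner_toC real_ofE.
pose N j := Re_poly (pdiff i j p v).
have NC j : (N j)^C = pdiff i j p v by apply: Re_polyK => k; apply: Im_coef_pdiff.
have NE j x : (pdiff i j p v).[toC x] = toC (N j).[x] by rewrite -horner_toC NC.
have sN j : (size (N j) < size a)%N.
  by rewrite sa ltnS -(size_map_poly (real_complex R)) NC size_pdiff.
have uv : upper_pt v by move=> k l; rewrite rv.
have ND j (s : C) : 0 < Im s -> Im ((N j)^C.[s] * (a^C.[s])^*%C) <= 0.
  by move=> s0; rewrite NC real_ofE//; apply: Im_pdiff_le0.
have avg x : lam <= x -> r%:R^-1 * \sum_j (N j).[x] < a.[x].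
  move=> /Hx; rewrite hornerD hornerN horner_mean_diff aE toC_nat_inv.
  under eq_bigr do rewrite NE.
  rewrite -rmorph_sum -rmorphM -rmorphB /=; lra.
(* At the last root [rho] of [a] the ratios are not defined, but each [N j] is nonnegative to the
   right of [rho], hence at [rho]. Their mean could then not be below [a.[rho] = 0]. *)
have a_gt0 x : lam <= x -> 0 < a.[x].
  move=> lx; rewrite ltNge; apply/negP => ax.
  have [|rho [xr ar Hr]] := last_root _ ax; first by rewrite la.
  have Nr j : 0 <= (N j).[rho].
    have := @horner_le0_near _ (- ((N j) \Po ('X + rho%:P))).
    rewrite hornerN horner_comp !hornerE oppr_le0; apply.
    exists 1 => // d d0 _; rewrite hornerN horner_comp !hornerE oppr_le0.
    apply: (nevanlinna_ge0 (ND j)) (sN j) _; last by rewrite la.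
    by move=> y dy; apply: Hr; lra.
  have := avg rho (le_trans lx xr); rewrite ar ltNge => /negP; apply.
  by rewrite mulr_ge0 ?invr_ge0// sumr_ge0.
have [j Hj] : exists j, (N j).[lam] < a.[lam].
  apply: contrapT => Hn; have := avg lam (lexx _); rewrite ltNge => /negP; apply.
  rewrite ler_pdivlMl ?ltr0n//.
  have -> : r%:R * a.[lam] = \sum_(j < r) a.[lam] by rewrite sumr_const card_ord mulr_natl.
  apply: ler_sum => j _; rewrite leNgt; apply/negP => h; apply: Hn; by exists j.
exists j => x lx; rewrite horner_shift_back aE NE -rmorphB /= subr_gt0.
have [w_le0 le] := nevanlinna_convex (ND j) (fun x lx => lt0r_neq0 (a_gt0 x lx)) lx.
rewrite -[a.[x]]mul1r -ltr_pdivrMr ?a_gt0//.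
apply: (@le_lt_trans _ _ ((N j).[lam] / a.[lam])); last first.
  by rewrite ltr_pdivrMr ?a_gt0// mul1r.
move: le; rewrite lerBlDr => /le_trans; apply.
rewrite gerDr mulr_ge0_le0// ?subr_ge0// mulr_le0_ge0// invr_ge0 sqr_ge0//.
Qed.

End Stable.

Lemma multiaffine_horner (p : V -> {poly C}) x :
  multiaffine p -> multiaffine (fun v => (p v).[x] : C^o).
Proof. by move=> ap i j s v; rewrite ap /pdiff hornerD hornerZ hornerD hornerN. Qed.

Lemma mean_diff_horner (p : V -> {poly C}) i x v :
  mean_diff i (fun v => (p v).[x] : C^o) v = (mean_diff i p v).[x].
Proof.
rewrite /mean_diff hornerZ horner_sum; congr (_ *: _); apply: eq_bigr => j _.
by rewrite /pdiff hornerD hornerN.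
Qed.

Lemma real_ptD v i (s : R) : real_pt v -> real_pt (v + toC s *: dir i).
Proof. by move=> rv k j; rewrite !mxE ImD rv add0r dirE -rmorphM. Qed.

Lemma upper_ptD v i (s : C) : 0 <= Im s -> real_pt v -> upper_pt (v + s *: dir i).
Proof.
by move=> s0 rv k j; rewrite !mxE ImD rv add0r dirE ImMr mulr_ge0// mulrn_wge0//.
Qed.

Lemma real_pt_horner (p : V -> {poly C}) M v (x : R) : real_stable M p -> real_pt v ->
  Im (p v).[toC x] = 0.
Proof.
by move=> rsp rv; rewrite -horner_Im_poly horner_coef big1// => k _; rewrite coef_Im_poly (rs_real rsp) ?mul0r.
Qed.

(** The limit of [Im_mean_diff_le0] as [x] descends to the real line, where the barrier argument
    keeps it. *)
Lemma Im_mean_diff_real (p : V -> {poly C}) M v (x : R) i : real_stable M p -> upper_pt v ->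
  Im ((mean_diff i p v).[toC x] * ((p v).[toC x])^*%C) <= 0.
Proof.
move=> rsp uv.
have := @Im_blowup_near _ (mean_diff i p v) (p v) (toC x) 'i%C 0 (p v).
rewrite !expr0 !mulr1; apply=> //.
have [e0 e0_gt0 He] := @stay_in_UHP _ (toC x) 'i%C (or_intror (conj erefl ltr01)).
exists e0 => // e e_gt0 ee0.
by apply: (Im_mean_diff_le0 rsp i uv); apply: He.
Qed.

(** * The barrier argument *)

Section Barrier.
Variables (lam phi : R).

(** The bounds are asked on the whole orthant spanned by the [dir k] above [y]: [nevanlinna_convex]
    needs positivity along entire half-lines, and the condition then passes to points above [y] by
    itself. *)
Definition above_roots (p : V -> {poly C}) (y : V) := forall t : 'I_n -> R,
  (forall k, 0 <= t k) ->
  let z := y + \sum_k toC (t k) *: dir k in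
  0 < Re (p z).[toC lam] /\
  forall i, Re (mean_diff i p z).[toC lam] <= phi * Re (p z).[toC lam].

(** Along [dir k] let [D] be [p], [N] be [mean_diff i p] and [F = N / D]. The new logarithmic
    derivative is [F d - F' d / (1 - D' / D)]. Convexity gives [F d <= phi + d * F' d]; since
    [F' <= 0], the shift compensates as soon as [d >= 1 / (1 - phi)], because [D' / D <= phi]. *)
Lemma above_roots_step M p y k (d : R) : real_stable M p -> real_pt y ->
    0 <= d -> 1 <= d * (1 - phi) -> above_roots p y ->
  above_roots (fun v => p v - mean_diff k p v) (y + toC d *: dir k).
Proof.
move=> rsp ry d0 dphi ab t t0.
rewrite addrAC; set z0 := y + \sum_k toC (t k) *: dir k => z.
have rz0 : real_pt z0.
  rewrite /z0; elim/big_rec: _ => [|i x _ IH]; first by rewrite addr0.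
  rewrite addrCA addrC; exact: real_ptD.
have abz s : 0 <= s -> 0 < Re (p (z0 + toC s *: dir k)).[toC lam] /\
    forall i, Re (mean_diff i p (z0 + toC s *: dir k)).[toC lam] <=
      phi * Re (p (z0 + toC s *: dir k)).[toC lam].
  move=> s0; have := ab (fun i => t i + s *+ (i == k)) _.
  have -> : y + \sum_i toC (t i + s *+ (i == k)) *: dir i = z0 + toC s *: dir k.
    rewrite /z0 -addrA; congr (_ + _).
    under eq_bigr do rewrite rmorphD scalerDl.
    rewrite big_split /=; congr (_ + _).
    rewrite (bigD1 k)//= eqxx mulr1n big1 ?addr0// => i /negbTE ->.
    by rewrite mulr0n scale0r.
  apply=> i; rewrite addr_ge0// mulrn_wge0//.
pose g := fun v => (p v).[toC lam] : C^o.
have ag : multiaffine g by apply/multiaffine_horner/(rs_affine rsp).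
have rg v : real_pt v -> Im (g v) = 0 by move=> rv; apply: (real_pt_horner _ rsp).
have [D HD] := line_poly ag rg k rz0.
have rmg i v : real_pt v -> Im (mean_diff i g v) = 0.
  move=> rv; rewrite mean_diff_horner horner_mean_diff toC_nat_inv mulrC ImMr Im_sum.
  rewrite big1 ?mul0r// => j _; rewrite /pdiff hornerD hornerN ImB.
  rewrite !(real_pt_horner _ rsp) ?subrr// -[e i j]scale1r; exact: real_pt_shift.
have HN i : exists N : {poly R}, forall s, N^C.[s] = mean_diff i g (z0 + s *: dir k) /\
    N^`()^C.[s] = mean_diff k (mean_diff i g) (z0 + s *: dir k).
  by apply: line_poly => //; [apply: multiaffine_mean|apply: rmg].
have DE s : D.[s] = Re (p (z0 + toC s *: dir k)).[toC lam].
  by rewrite -[D.[s]]/(Re (toC D.[s])) -horner_toC (proj1 (HD _)).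
have D'E s : D^`().[s] = Re (mean_diff k p (z0 + toC s *: dir k)).[toC lam].
  by rewrite -[_.[s]]/(Re (toC _.[s])) -horner_toC (proj2 (HD _)) mean_diff_horner.
have [ab0 ab0'] := abz d d0; rewrite -/z in ab0 ab0' *.
have D_gt0 x : 0 <= x -> 0 < D.[x] by move=> x0; rewrite DE; have [] := abz x x0.
have D' : D^`().[d] <= phi * D.[d] by rewrite D'E DE.
have qE : Re (p z - mean_diff k p z).[toC lam] = D.[d] - D^`().[d].
  by rewrite DE D'E hornerD hornerN -/z; case: (_.[_]) (_.[_]) => [? ?] [? ?].
rewrite qE; split.
  have := D_gt0 d d0; have : 0 < 1 - phi by move: dphi; rewrite leNgt; nra.
  nra.
move=> i; have [N HN'] := HN i.
have NE s : N.[s] = Re (mean_diff i p (z0 + toC s *: dir k)).[toC lam].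
  by rewrite -[N.[s]]/(Re (toC N.[s])) -horner_toC (proj1 (HN' _)) mean_diff_horner.
have mqE : Re (mean_diff i (fun v => p v - mean_diff k p v) z).[toC lam] = N.[d] - N^`().[d].
  rewrite NE -[N^`().[d]]/(Re (toC N^`().[d])) -horner_toC (proj2 (HN' _)).
  rewrite mean_diffC -/z.
  have -> : mean_diff i (mean_diff k g) z = (mean_diff i (mean_diff k p) z).[toC lam].
    rewrite /mean_diff hornerZ horner_sum; congr (_ *: _); apply: eq_bigr => j _.
    by rewrite {1}/pdiff -!/(mean_diff k g _) !mean_diff_horner /pdiff hornerD hornerN.
  have -> : mean_diff i (fun v => p v - mean_diff k p v) z = mean_diff i p z - mean_diff i (mean_diff k p) z.
    rewrite /mean_diff -scalerBr; congr (_ *: _); rewrite -sumrB; apply: eq_bigr => j _.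
    by rewrite pdiffB.
  by rewrite hornerD hornerN; case: (_.[_]) (_.[_]) => [? ?] [? ?].
have ND (s : C) : 0 < Im s -> Im (N^C.[s] * (D^C.[s])^*%C) <= 0.
  move=> s0; rewrite (proj1 (HN' _)) (proj1 (HD _)) mean_diff_horner.
  by apply: (Im_mean_diff_real _ _ rsp); apply: upper_ptD => //; apply: ltW.
have [w_le0 le] := nevanlinna_convex ND (fun x x0 => lt0r_neq0 (D_gt0 x x0)) d0.
have N0 : N.[0] / D.[0] <= phi.
  rewrite ler_pdivrMr ?D_gt0//; have [_ /(_ i)] := abz 0 (lexx _).
  by rewrite -NE -DE.
rewrite mqE; move: w_le0 le; rewrite /wron subr0.
have := D_gt0 d d0; move: N.[d] D.[d] N^`().[d] D^`().[d] D' => a b a' b' b'b b_gt0.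
set w := a' * b - a * b' => w_le0 le.
have phi_lt1 : 0 < 1 - phi by move: dphi; rewrite leNgt; nra.
(* This is [N - N' = F * (D - D') - F' * D], with [w / b] for [F' * D]. *)
have aE : a - a' = a / b * (b - b') - w / b by rewrite /w; field; rewrite gt_eqF.
have bb : 0 < b - b' by nra.
have le1 : a / b <= phi + d * (w / b ^+ 2) by lra.
rewrite aE; apply: (@le_trans _ _ ((phi + d * (w / b ^+ 2)) * (b - b') - w / b)).
  by rewrite lerD2r ler_pM2r.
have -> : (phi + d * (w / b ^+ 2)) * (b - b') - w / b =
   phi * (b - b') + (w / b) * (d * ((b - b') / b) - 1) by field; rewrite gt_eqF.
rewrite gerDl mulr_le0_ge0//; first by rewrite mulr_le0_ge0// invr_ge0 ltW.
rewrite subr_ge0 (le_trans dphi)// ler_wpM2l// ler_pdivlMr//; lra.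
Qed.

(** The head of the list is applied last, so [select_colouring] undoes it first, while the rest of
    the average is still stable. *)
Definition average (l : seq 'I_n) (p : V -> {poly C}) :=
  foldr (fun i q v => q v - mean_diff i q v) p l.

Lemma real_stable_average M l p : (0 < r)%N -> real_stable M p -> real_stable M (average l p).
Proof. by move=> r0 rsp; elim: l => //= i l IH; apply: real_stable_step. Qed.

Lemma above_roots_average M l p y (d : R) : (0 < r)%N -> real_stable M p -> real_pt y ->
    0 <= d -> 1 <= d * (1 - phi) -> above_roots p y ->
  above_roots (average l p) (y + toC d *: \sum_(i <- l) dir i).
Proof.
move=> r0 rsp ry d0 dphi ab; elim: l => [|i l IH] /=.
  by rewrite big_nil scaler0 addr0.
rewrite big_cons scalerDr addrCA addrC.
apply: (above_roots_step (M := M)) => //; first exact: real_stable_average.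
elim: l {IH} => [|k l IH]; first by rewrite big_nil scaler0 addr0.
by rewrite big_cons scalerDr addrCA addrC; apply: real_ptD.
Qed.

End Barrier.

Theorem select_colouring M p l v (lam : R) : (0 < r)%N -> real_stable M p -> real_pt v ->
    uniq l -> (forall x, lam <= x -> 0 < Re (average l p v).[toC x]) ->
  exists c : 'I_n -> 'I_r, forall x, lam <= x ->
    0 < Re (p (v - \sum_(i <- l) e i (c i))).[toC x].
Proof.
move=> r0 rsp; elim: l v => [|i l IH] v rv /=.
  by move=> _ H; exists (fun=> Ordinal r0) => x; rewrite big_nil subr0; apply: H.
move=> /andP[il ul] H.
have [j Hj] := select_colour (real_stable_average l r0 rsp) r0 rv H.
have rv' : real_pt (v - e i j).
  by rewrite -[- e i j]scaleN1r; apply: real_pt_shift => //=; rewrite oppr0.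
have [c Hc] := IH _ rv' ul Hj.
(* As [l] has no repetitions, recolouring [i] does not affect the indices of the tail. *)
exists (fun k => if k == i then j else c k) => x /Hc.
rewrite big_cons eqxx opprD addrA.
rewrite [in X in _ -> X]big_seq [in X in X -> _]big_seq.
under [in X in _ -> X]eq_bigr => k kl.
  have -> : (k == i) = false by apply: contraNF il => /eqP <-.
  over.
by [].
Qed.

End MultiAffine.

(** * Contractions and their determinantal polynomials *)

Section HermitianForms.
Variables (R : rcfType) (n : nat).
Local Notation C := R[i].
Local Notation toC := (real_complex R).
Local Notation Re := (@complex.Re R).
Local Notation Im := (@complex.Im R).
Implicit Types (x y z : 'rV[C]_n) (A : 'M[C]_n).

Definition dotc x y : C := \sum_k x 0 k * (y 0 k)^*%C.

Definition sqn y : R := Re (dotc y y).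

Definition hermitian A := forall i k, A k i = (A i k)^*%C.

Definition contraction A := hermitian A /\
  forall y, 0 <= Re (dotc (y *m A) y) <= sqn y.

Lemma dotcBl x y z : dotc (x - y) z = dotc x z - dotc y z.
Proof. by rewrite /dotc -sumrB; apply: eq_bigr => k _; rewrite !mxE mulrBl. Qed.

Lemma dotcBr x y z : dotc z (x - y) = dotc z x - dotc z y.
Proof. by rewrite /dotc -sumrB; apply: eq_bigr => k _; rewrite !mxE rmorphB mulrBr. Qed.

Lemma dotcZl c x z : dotc (c *: x) z = c * dotc x z.
Proof. by rewrite /dotc mulr_sumr; apply: eq_bigr => k _; rewrite !mxE mulrA. Qed.

Lemma dotcZr c x z : dotc z (c *: x) = c^*%C * dotc z x.
Proof. by rewrite /dotc mulr_sumr; apply: eq_bigr => k _; rewrite !mxE rmorphM mulrCA. Qed.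

Lemma dotcJ x y : dotc y x = (dotc x y)^*%C.
Proof.
rewrite /dotc rmorph_sum; apply: eq_bigr => k _.
by rewrite rmorphM /= conjcK mulrC.
Qed.

Lemma mulJ_toC (z : C) : z * z^*%C = toC (Re z ^+ 2 + Im z ^+ 2).
Proof. by case: z => a b; apply/eqP; rewrite eq_complex /=; apply/andP; split; apply/eqP; ring. Qed.

Lemma sqnE y : sqn y = \sum_k (Re (y 0 k) ^+ 2 + Im (y 0 k) ^+ 2).
Proof.
rewrite /sqn /dotc; under eq_bigr do rewrite mulJ_toC.
by rewrite -rmorph_sum.
Qed.

Lemma dotc_toC y : dotc y y = toC (sqn y).
Proof.
rewrite sqnE rmorph_sum; apply: eq_bigr => k _; exact: mulJ_toC.
Qed.

Lemma sqn_ge0 y : 0 <= sqn y.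
Proof. by rewrite sqnE sumr_ge0// => k _; rewrite addr_ge0 ?sqr_ge0. Qed.

Lemma sqn_eq0 y : sqn y <= 0 -> y = 0.
Proof.
move=> y0; apply/rowP => k; rewrite mxE.
have : \sum_k (Re (y 0 k) ^+ 2 + Im (y 0 k) ^+ 2) = 0.
  by apply/eqP; rewrite eq_le -sqnE y0 sqn_ge0.
move=> /psumr_eq0P H.
have /eqP := H (fun k _ => addr_ge0 (sqr_ge0 _) (sqr_ge0 _)) k isT.
rewrite paddr_eq0 ?sqr_ge0// !sqrf_eq0 => /andP[/eqP r0 /eqP i0].
by apply/eqP; rewrite eq_complex r0 i0 !eqxx.
Qed.

Lemma sqnZ c y : sqn (c *: y) = Re (c * c^*%C) * sqn y.
Proof.
rewrite /sqn dotcZl dotcZr mulrA dotc_toC mulJ_toC -rmorphM //.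
Qed.

Lemma dotc_hermitian A x y : hermitian A -> dotc (x *m A) y = dotc x (y *m A).
Proof.
move=> hA; rewrite /dotc.
under eq_bigr do rewrite mxE mulr_suml.
rewrite exchange_big; apply: eq_bigr => i _.
rewrite mxE rmorph_sum mulr_sumr; apply: eq_bigr => k _.
by rewrite rmorphM /= -hA -mulrA [A i k * _]mulrC.
Qed.

Lemma Im_form A y : hermitian A -> Im (dotc (y *m A) y) = 0.
Proof.
move=> hA; have := dotcJ (y *m A) y; rewrite -dotc_hermitian//.
by case: (dotc _ _) => a b [] h /=; lra.
Qed.

Section Contraction.
Variable A : 'M[C]_n.
Hypothesis cA : contraction A.

(** This is [A ^+ 2 <= A]: combine the lower bound of the form at [y - y A] with the upper bound at
    [y A]. *)
Lemma sqn_mulmx y : sqn (y *m A) <= Re (dotc (y *m A) y).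
Proof.
have [hA psd] := cA; have /andP[+ _] := psd (y - y *m A).
have /andP[_] := psd (y *m A).
rewrite mulmxBl dotcBl !dotcBr.
rewrite [dotc (y *m A *m A) y](dotc_hermitian _ _ hA).
rewrite /sqn.
move: (dotc (y *m A) y) (dotc (y *m A) (y *m A)) (dotc (y *m A *m A) _) => [a ?] [b ?] [c ?] /=.
by lra.
Qed.

Lemma form_eq0 y : Re (dotc (y *m A) y) <= 0 -> y *m A = 0.
Proof. by move=> h; apply/sqn_eq0/(le_trans (sqn_mulmx y)). Qed.

(** The Cauchy-Schwarz inequality of the semidefinite form of [A], between [y] and the basis vector
    of index [i]. *)
Lemma sqn_entry y i (delta : R) : 0 < delta -> Re (A i i) <= delta ->
  Re ((y *m A) 0 i) ^+ 2 + Im ((y *m A) 0 i) ^+ 2 <= delta * Re (dotc (y *m A) y).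
Proof.
move=> d_gt0 Aii; have [hA psd] := cA.
set w := (y *m A) 0 i; set t := w * toC delta^-1.
have := psd (y - t *: delta_mx 0 i) => /andP[+ _].
rewrite mulmxBl dotcBl !dotcBr -scalemxAl !dotcZl !dotcZr.
have dE x : dotc x (delta_mx 0 i) = x 0 i.
  rewrite /dotc (bigD1 i)//= big1 ?addr0; last first.
    by move=> k ki; rewrite !mxE (negbTE ki) andbF rmorph_nat mulr0.
  by rewrite !mxE !eqxx rmorph_nat mulr1.
rewrite [dotc (delta_mx 0 i *m A) y](dotc_hermitian _ _ hA) [dotc (delta_mx 0 i) _]dotcJ.
have AE : ((delta_mx 0 i : 'rV[C]_n) *m A) 0 i = A i i by rewrite -rowE mxE.
rewrite !dE AE -/w.
have -> : A i i = toC (Re (A i i)).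
  by apply: Im0_toC; have := hA i i; case: (A i i) => a b [] h /=; lra.
rewrite /t; move: (Re (A i i)) Aii => a ad.
have di_gt0 : 0 < delta^-1 by rewrite invr_gt0.
move: (dotc _ _) => [q ?]; case: (w) => w1 w2 /= H.
have {}H : 0 <= q - (w1 ^+ 2 + w2 ^+ 2) * (2 * delta^-1 - delta^-1 ^+ 2 * a) by lra.
set s := w1 ^+ 2 + w2 ^+ 2 in H *.
have s_ge0 : 0 <= s by rewrite addr_ge0 ?sqr_ge0.
have : delta^-1 ^+ 2 * a <= delta^-1.
  by rewrite expr2 -mulrA ger_pMr// mulrC ler_pdivrMr// mul1r.
move=> h2; rewrite mulrC -ler_pdivrMr//; nra.
Qed.

End Contraction.
End HermitianForms.

Lemma char_poly_mulC (F : idomainType) n (A B : 'M[F]_n) :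
  char_poly (A *m B) = char_poly (B *m A).
Proof.
rewrite /char_poly /char_poly_mx !map_mxM /=.
set a := map_mx polyC A; set b := map_mx polyC B.
(* Both determinants are Schur complements of the block matrix [1, b; a, 'X]. *)
pose P := block_mx 1%:M b a 'X%:M : 'M[{poly F}]_(n + n).
have P1 : P *m block_mx 1%:M (- b) 0 1%:M = block_mx 1%:M 0 a ('X%:M - a *m b).
  rewrite mulmx_block !mulmx1 !mul1mx !mulmx0 !addr0 mulmxN addNr.
  by rewrite addrC.
have P2 : P *m block_mx 'X%:M 0 (- a) 1%:M = block_mx ('X%:M - b *m a) b 0 'X%:M.
  rewrite mulmx_block !mulmx1 !mul1mx !mulmx0 !add0r !mulmxN scalar_mxC.
  by rewrite subrr.
have X0 : ('X : {poly F}) ^+ n != 0 by rewrite expf_neq0// polyX_eq0.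
apply: (mulIf X0).
have := congr1 determinant P1; have := congr1 determinant P2.
rewrite !det_mulmx !det_lblock !det_ublock !det1 !mulr1 !mul1r !det_scalar.
by move=> <- <-.
Qed.

Lemma char_poly_row_combine (F : comNzRingType) n (i : 'I_n) (M M0 M1 : 'M[F]_n) (s : F) :
    (forall a b, a != i -> M0 a b = M a b) -> (forall a b, a != i -> M1 a b = M a b) ->
    (forall b, M i b = (1 - s) * M0 i b + s * M1 i b) ->
  char_poly M = (1 - s)%:P * char_poly M0 + s%:P * char_poly M1.
Proof.
move=> H0 H1 H; rewrite /char_poly; apply: (@determinant_multilinear _ _ _ _ _ i).
- apply/rowP => b; rewrite !mxE H polyCD !polyCM polyCB.
  move: ('X *+ _) (M0 i b)%:P (M1 i b)%:P s%:P => x y z t; ring.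
- by apply/matrixP => a b; rewrite !mxE H0// eq_sym neq_lift.
- by apply/matrixP => a b; rewrite !mxE H1// eq_sym neq_lift.
Qed.

(** * Stability of the determinantal polynomial *)

Section DeterminantalPolynomial.
Variables (R : rcfType) (n r : nat).
Local Notation C := R[i].
Local Notation toC := (real_complex R).
Local Notation Re := (@complex.Re R).
Local Notation Im := (@complex.Im R).
Local Notation V := 'M[C]_(n, r).
Variable A : 'M[C]_n.

Definition row_scale (d : 'I_n -> C) : 'M[C]_n := \matrix_(i, k) (d i * A i k).

(** Each factor [det (X + diag (v _ j) A)] is written as the characteristic polynomial of the
    negated matrix, so that roots become eigenvalues. *)
Definition det_poly (v : V) : {poly C} :=
  \prod_j char_poly (- row_scale (fun i => v i j)).

Lemma root_row_scale (d : 'I_n -> C) (x : C) : root (char_poly (- row_scale d)) x ->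
  exists2 z : 'rV[C]_n, z != 0 & (\row_k (z 0 k * d k)) *m A = - x *: z.
Proof.
rewrite -eigenvalue_root_char => /eigenvalueP[z zE z0]; exists z => //.
rewrite scaleNr -zE mulmxN opprK; apply/rowP => k; rewrite !mxE.
by apply: eq_bigr => i _; rewrite !mxE mulrA.
Qed.

Lemma det_poly_monic v : det_poly v \is monic.
Proof. by apply: monic_prod => j _; apply: char_poly_monic. Qed.

Lemma size_det_poly v : size (det_poly v) = (r * n).+1.
Proof.
rewrite size_prod; last by move=> j _; apply/monic_neq0/char_poly_monic.
under eq_bigr do rewrite size_char_poly.
by rewrite sum_nat_const card_ord mulnS addnC -addSn addnK.
Qed.

Lemma char_poly_row_scale_combine (i : 'I_n) (s : C) (d d0 d1 : 'I_n -> C) :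
    (forall k, k != i -> d0 k = d k) -> (forall k, k != i -> d1 k = d k) ->
    d i = (1 - s) * d0 i + s * d1 i ->
  char_poly (- row_scale d) =
  (1 - s)%:P * char_poly (- row_scale d0) + s%:P * char_poly (- row_scale d1).
Proof.
move=> H0 H1 H; apply: (char_poly_row_combine (i := i)).
- by move=> a b ai; rewrite !mxE H0.
- by move=> a b ai; rewrite !mxE H1.
- by move=> b; rewrite !mxE H; move: (d0 i) (d1 i) (A i b) => x y z; ring.
Qed.

Lemma prod_multiaffine (G : ('I_n -> C) -> {poly C}) :
    (forall i s d d0 d1,
      (forall k, k != i -> d0 k = d k) -> (forall k, k != i -> d1 k = d k) ->
      d i = (1 - s) * d0 i + s * d1 i -> G d = (1 - s)%:P * G d0 + s%:P * G d1) ->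
  multiaffine (fun v : V => \prod_j G (fun i => v i j)).
Proof.
move=> HG i j s v.
pose F w := G (fun k => (v + w *: delta_mx i j) k j).
pose P := \prod_(l < r | l != j) G (fun k => v k l).
have detE w : \prod_l G (fun k => (v + w *: delta_mx i j) k l) = F w * P.
  rewrite (bigD1 j isT); congr (_ * _).
  apply: eq_bigr => l lj; congr G; apply/funext => a.
  by rewrite !mxE (negbTE lj) andbF mulr0 addr0.
have FE : F s = (1 - s)%:P * F 0 + s%:P * F 1.
  apply: (HG i) => [a ai|a ai|]; rewrite !mxE.
  - by rewrite (negbTE ai) !mulr0.
  - by rewrite (negbTE ai) !mulr0.
  - by rewrite !eqxx /=; ring.
have := detE 0; rewrite scale0r addr0 => det0.
have := detE 1; rewrite scale1r => det1.
rewrite detE FE /pdiff det0 det1 -!mul_polyC polyCB polyC1.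
move: (F 0) (F 1) (P) (s%:P) => f0 f1 q t; ring.
Qed.

Lemma det_poly_multiaffine : multiaffine det_poly.
Proof. exact: (prod_multiaffine char_poly_row_scale_combine). Qed.

Hypothesis cA : contraction A.

(** For real diagonal [D] the conjugate of [D A] is the transpose of [A D], whose characteristic
    polynomial is that of [D A]. *)
Lemma conj_char_poly_row_scale (d : 'I_n -> C) : (forall i, Im (d i) = 0) ->
  map_poly (@conjc R) (char_poly (- row_scale d)) = char_poly (- row_scale d).
Proof.
move=> rd; rewrite map_char_poly.
pose D := diag_mx (\row_i - d i).
have -> : - row_scale d = D *m A.
  by rewrite mul_diag_mx; apply/matrixP => i k; rewrite !mxE mulNr.
rewrite [in RHS]char_poly_mulC /char_poly -[RHS]det_tr; congr (\det _).
apply/matrixP => i k; rewrite /D mul_diag_mx mul_mx_diag !mxE eq_sym.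
congr (_ - _%:P); have [hA _] := cA.
rewrite rmorphM rmorphN (hA i k) mulrC; congr (_ * - _).
rewrite (Im0_toC (rd i)); exact: conjc_real.
Qed.

Lemma det_poly_real v : real_pt v -> forall k, Im (det_poly v)`_k = 0.
Proof.
move=> rv k.
have : map_poly (@conjc R) (det_poly v) = det_poly v.
  rewrite rmorph_prod; apply: eq_bigr => j _ /=; apply: conj_char_poly_row_scale => i.
  exact: rv.
move=> /(congr1 (fun p : {poly C} => p`_k)); rewrite coef_map /=.
by case: (_`_k) => a b [] h /=; lra.
Qed.

Lemma form_row_scale (z : 'rV[C]_n) (d : 'I_n -> C) (x : C) :
    (\row_k (z 0 k * d k)) *m A = - x *: z ->
  dotc ((\row_k (z 0 k * d k)) *m A) (\row_k (z 0 k * d k)) =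
  - x * \sum_k toC (Re (z 0 k) ^+ 2 + Im (z 0 k) ^+ 2) * (d k)^*%C.
Proof.
move=> ->; rewrite dotcZl; congr (_ * _); apply: eq_bigr => k _.
by rewrite mxE rmorphM mulrA mulJ_toC.
Qed.

(** For an eigenvector [z] and [y = z diag(d)], the real number [q = dotc (y A) y] is [- x] times
    the sum of [|z_k|^2 (d_k)^*]. Multiplying by [x^*] and taking imaginary parts gives
    [- Im x * q >= 0]; so [y A = 0], and [- x z = y A] forces [z = 0]. *)
Lemma char_poly_row_scale_neq0 (d : 'I_n -> C) (x : C) : (forall i, 0 <= Im (d i)) ->
  0 < Im x -> (char_poly (- row_scale d)).[x] != 0.
Proof.
move=> ud x0; apply/negP => /root_row_scale[z z0 zE].
set y := (\row_k (z 0 k * d k)) in zE.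
have qE := form_row_scale zE; rewrite -/y in qE.
have [hA psd] := cA; have q_real := Im_form y hA.
have yA : y *m A = 0.
  apply: (form_eq0 cA).
  have : Im (x^*%C * dotc (y *m A) y) = Re (x * x^*%C) * \sum_k (Re (z 0 k) ^+ 2 + Im (z 0 k) ^+ 2) * Im (d k).
    rewrite qE mulrA mulrN [x^*%C * x]mulrC mulJ_toC -rmorphN mulrC ImMr Im_sum /=.
    rewrite mulrN mulrC -mulrN -sumrN; congr (_ * _); apply: eq_bigr => k _.
    rewrite mulrC ImMr; case: (d k) => a b /=; ring.
  rewrite (Im0_toC q_real) ImMr => H.
  have : 0 <= Re (x * x^*%C) * \sum_k (Re (z 0 k) ^+ 2 + Im (z 0 k) ^+ 2) * Im (d k).
    rewrite mulr_ge0//; first by rewrite mulJ_toC /= addr_ge0 ?sqr_ge0.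
    by apply: sumr_ge0 => k _; rewrite mulr_ge0// addr_ge0 ?sqr_ge0.
  by rewrite -H; case: (x) x0 => x1 x2 /= x0; rewrite nmulr_rge0// oppr_lt0.
move: zE; rewrite yA => /esym/eqP; rewrite scaler_eq0 oppr_eq0 (negbTE z0) orbF => /eqP x00.
by rewrite x00 ltxx in x0.
Qed.

Theorem det_poly_stable : real_stable (r * n) det_poly.
Proof.
split; [exact: det_poly_multiaffine|exact: det_poly_real| |].
  move=> v x uv x0; rewrite horner_prod prodf_seq_neq0; apply/allP => j _ /=.
  by apply: char_poly_row_scale_neq0 => // i; apply: uv.
move=> v; apply/leq_sizeP => k; rewrite leq_eqVlt => /predU1P[<-|kM].
  have := monicP (det_poly_monic v); rewrite lead_coefE size_det_poly /= => lE.
  by rewrite coefB coefXn eqxx lE subrr.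
by rewrite coefB coefXn gtn_eqF// subr0 nth_default// size_det_poly.
Qed.

End DeterminantalPolynomial.

(** * The starting point of the barrier *)

Section Paving.
Variables (R : rcfType) (n r : nat).
Local Notation C := R[i].
Local Notation toC := (real_complex R).
Local Notation Re := (@complex.Re R).
Local Notation Im := (@complex.Im R).
Local Notation V := 'M[C]_(n, r).
Variables (A : 'M[C]_n) (delta : R).
Hypotheses (cA : contraction A) (delta_gt0 : 0 < delta).
Hypothesis Adelta : forall i, Re (A i i) <= delta.

(** At a root, [q = dotc (y A) y] is at most [lam * (b * |z|^2 + tau * |z_i|^2)]. Since
    [y A = - lam z], [sqn_mulmx] and [sqn_entry] bound [lam^2 |z|^2] by [q] and [lam^2 |z_i|^2] by
    [delta * q]. Hence [lam * q <= (b + tau * delta) * q], and [q] cannot be positive. *)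
Lemma char_poly_row_scale_real_neq0 (d : 'I_n -> C) (i : 'I_n) (b tau lam : R) :
    (forall k, Im (d k) = 0) -> 0 <= b -> 0 <= tau -> b + tau * delta < lam ->
    (forall k, - b - tau *+ (k == i) <= Re (d k)) ->
  (char_poly (- row_scale A d)).[toC lam] != 0.
Proof.
move=> rd b0 tau0 blam db; apply/negP => /root_row_scale[z z0 zE].
have qE := form_row_scale zE.
set y := (\row_k (z 0 k * d k)) in zE qE.
have lam_gt0 : 0 < lam by have := mulr_ge0 tau0 (ltW delta_gt0); lra.
pose m k := Re (z 0 k) ^+ 2 + Im (z 0 k) ^+ 2.
have m_ge0 k : 0 <= m k by rewrite addr_ge0 ?sqr_ge0.
set q := Re (dotc (y *m A) y).
have qle : q <= lam * (b * sqn z + tau * m i).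
  rewrite /q qE.
  have -> : \sum_k toC (m k) * (d k)^*%C = toC (\sum_k m k * Re (d k)).
    rewrite rmorph_sum; apply: eq_bigr => k _; rewrite rmorphM.
    by rewrite {1}(Im0_toC (rd k)) conjc_real.
  rewrite -rmorphN -rmorphM /= mulNr -mulrN ler_pM2l// -sumrN (sqnE z : _ = \sum_k m k) mulr_sumr.
  rewrite (bigD1 i)//= [X in _ <= X + _](bigD1 i)//= addrAC; apply: lerD.
    have := db i; rewrite eqxx mulr1n => h.
    by have := ler_wpM2l (m_ge0 i) h; lra.
  apply: ler_sum => k ki; have := db k; rewrite (negbTE ki) mulr0n subr0 => h.
  by have := ler_wpM2l (m_ge0 k) h; lra.
have h1 : lam ^+ 2 * sqn z <= q.
  have := sqn_mulmx cA y; rewrite -/q zE sqnZ.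
  by have -> : Re (- toC lam * (- toC lam)^*%C) = lam ^+ 2 by rewrite /=; ring.
have h2 : lam ^+ 2 * m i <= delta * q.
  have := sqn_entry cA y delta_gt0 (Adelta i); rewrite -/q zE mxE /m.
  move: (z 0 i) => [a c] /= h; apply: le_trans h.
  by rewrite le_eqVlt; apply/orP; left; apply/eqP; ring.
have q_le0 : q <= 0.
  have : lam * q <= b * q + tau * (delta * q).
    apply: (@le_trans _ _ (b * (lam ^+ 2 * sqn z) + tau * (lam ^+ 2 * m i))).
      have := qle; rewrite -(ler_pM2l lam_gt0) => /le_trans; apply.
      by rewrite le_eqVlt; apply/orP; left; apply/eqP; ring.
    by apply: lerD; rewrite ler_wpM2l.
  move=> H; rewrite leNgt; apply/negP => q_gt0.
  have : 0 < (lam - (b + tau * delta)) * q by rewrite mulr_gt0// subr_gt0.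
  by lra.
have yA := form_eq0 cA q_le0.
move: zE; rewrite yA => /esym/eqP; rewrite scaler_eq0 oppr_eq0 (negbTE z0) orbF.
by rewrite -(rmorph0 toC) (inj_eq (@complexI _)) gt_eqF.
Qed.

(* One coordinate may go below [- b] by [tau]; as [det_poly] is affine in that coordinate,
   positivity there bounds its logarithmic derivative by [1 / tau]. *)
Lemma det_poly_gt0 (v : V) i j (b tau lam : R) :
    real_pt v -> 0 <= b -> 0 <= tau -> b + tau * delta < lam ->
    (forall k l, - b - tau *+ ((k == i) && (l == j)) <= Re (v k l)) ->
  0 < Re (det_poly A v).[toC lam].
Proof.
move=> rv b0 tau0 blam vb; have rsp := det_poly_stable r cA.
have [_ la] := lead_real_of rsp rv.
have aE x : (det_poly A v).[toC x] = toC (real_of (det_poly A) v).[x].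
  by rewrite -horner_toC (real_ofE rsp).
rewrite aE ltNge; apply/negP => /last_root[|rho [lr rr _]]; first by rewrite la.
have := aE rho; rewrite rr rmorph0 => /eqP; apply/negP.
rewrite horner_prod prodf_seq_neq0; apply/allP => l _ /=.
apply: (@char_poly_row_scale_real_neq0 _ i b tau) => //; first lra.
move=> k; apply: le_trans (vb k l); rewrite lerD2l lerN2.
by case: (k == i); case: (l == j).
Qed.

(** Points above the start have entries at least [- d / r], so one entry can still be lowered by
    [tau]. The start lies at [- d] along every [dir k]: one barrier step per index, each of length
    [d], then ends at the origin. *)
Lemma above_roots_start (d tau lam : R) : (0 < n)%N -> (0 < r)%N -> 0 <= d -> 0 < tau ->
    d / r%:R + tau * delta < lam ->
  above_roots lam tau^-1 (det_poly A : V -> _) (toC (- d) *: \sum_k dir R r k).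
Proof.
move=> n_gt0 r_gt0 d0 tau0 dlam t t0 z.
have zE k l : z k l = toC ((t k - d) / r%:R).
  rewrite /z !mxE !summxE.
  have dE (c : 'I_n -> R) : \sum_i (toC (c i) *: dir R r i) k l = toC (c k / r%:R).
    rewrite (bigD1 k)//= big1 ?addr0; last first.
      by move=> i /negbTE ik; rewrite mxE dirE eq_sym ik mulr0n rmorph0 mulr0.
    by rewrite mxE dirE eqxx mulr1n -rmorphM.
  rewrite dE.
  have -> : \sum_i (dir R r i) k l = toC r%:R^-1.
    have := dE (fun=> 1); rewrite mul1r => <-.
    by apply: eq_bigr => i _; rewrite rmorph1 scale1r.
  by rewrite -rmorphM -rmorphD mulNr addrC -mulrBl.
have rz : real_pt z by move=> k l; rewrite zE.
have zb k l : - (d / r%:R) <= Re (z k l).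
  by rewrite zE /= mulrBl lerDr divr_ge0.
clearbody z.
have d'0 : 0 <= d / r%:R by rewrite divr_ge0.
have td : 0 <= tau * delta by rewrite mulr_ge0// ltW.
have pos i j (s : R) : 0 <= s -> s <= tau ->
    0 < Re (det_poly A (z + toC (- s) *: delta_mx i j)).[toC lam].
  move=> s0 st; apply: (@det_poly_gt0 _ i j (d / r%:R) s) => //.
  - by apply: real_pt_shift.
  - by apply: le_lt_trans dlam; rewrite lerD2l ler_wpM2r// ltW.
  - move=> k l; rewrite !mxE; have := zb k l.
    case: (_ && _); rewrite !(mulr1n, mulr0n, mulr1, mulr0, addr0, subr0)//.
    by case: (z k l) => a c /=; lra.
have rsp := det_poly_stable r cA.
split.
  have := pos (Ordinal n_gt0) (Ordinal r_gt0) 0 (lexx _) (ltW tau0).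
  by rewrite oppr0 rmorph0 scale0r addr0.
move=> i; rewrite horner_mean_diff toC_nat_inv mulrC.
have -> (w : C) : Re (w * toC r%:R^-1) = Re w * r%:R^-1 by case: w => a b /=; ring.
rewrite ler_pdivrMr ?ltr0n//.
rewrite Re_sum.
have -> : tau^-1 * Re (det_poly A z).[toC lam] * r%:R =
   \sum_(j < r) tau^-1 * Re (det_poly A z).[toC lam].
  by rewrite sumr_const card_ord mulr_natr.
apply: ler_sum => j _; rewrite ler_pdivlMl//.
have := pos i j tau (ltW tau0) (lexx _).
rewrite (rs_affine rsp) hornerD hornerZ.
move: (pdiff _ _ _ _).[_] (det_poly A z).[_] => [a ?] [b ?] /=; lra.
Qed.

End Paving.

(** By the spectral theorem: the rows of the unitary matrix are eigenvectors, so the hypothesis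
    bounds every diagonal entry by [lam]. *)
Lemma hermitian_form_le (R : rcfType) n (B : 'M[R[i]]_n) (lam : R) : hermitian B ->
    (forall (x : R) (w : 'rV[R[i]]_n), lam < x -> w *m B = real_complex R x *: w -> w = 0) ->
  forall y, complex.Re (dotc (y *m B) y) <= lam * sqn y.
Proof.
move=> hB Blam y.
have Bn : B \is normalmx.
  apply/normalmxP; suff -> : map_mx Num.conj B^T = B by [].
  by apply/matrixP => i k; rewrite !mxE [RHS]hB.
have [P [sp [Pu BE]]] : exists P, exists sp, P \is unitarymx /\ B = invmx P *m diag_mx sp *m P.
  exists (spectralmx B), (spectral_diag B); split; first exact: spectral_unitarymx.
  exact/orthomx_spectralP.
have Punit := unitarymx_unit Pu.
have adj (M : 'M[R[i]]_n) x z : dotc (x *m M) z = dotc x (z *m map_mx Num.conj M^T).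
  rewrite /dotc; under eq_bigr do rewrite mxE mulr_suml.
  rewrite exchange_big; apply: eq_bigr => i _.
  rewrite mxE rmorph_sum mulr_sumr; apply: eq_bigr => k _.
  by rewrite !mxE rmorphM /= [X in _ = _ * (_ * X)]conjcK -mulrA [M i k * _]mulrC.
have PB : P *m B = diag_mx sp *m P by rewrite BE -mulmxA mulKVmx.
have spB i : row i P *m B = sp 0 i *: row i P.
  rewrite -row_mul PB; apply/rowP => k; rewrite mul_diag_mx !mxE; by [].
have spP i : row i P != 0.
  apply/eqP => Pi; have := congr1 (fun M => (row i M) 0 i) (mulmxV Punit).
  by rewrite row_mul Pi mul0mx !mxE eqxx => /esym/eqP; rewrite oner_eq0.
have sqP i : 0 < sqn (row i P).
  by rewrite ltNge; apply/negP => /sqn_eq0/eqP; rewrite (negbTE (spP i)).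
have sp_real i : complex.Im (sp 0 i) = 0.
  have := Im_form (row i P) hB; rewrite spB dotcZl dotc_toC ImMr => /eqP.
  by rewrite mulf_eq0 (gt_eqF (sqP i)) orbF => /eqP.
have sp_le i : complex.Re (sp 0 i) <= lam.
  rewrite leNgt; apply/negP => ltl; have := @Blam _ (row i P) ltl.
  by rewrite spB -(Im0_toC (sp_real i)) => /(_ erefl)/eqP; rewrite (negbTE (spP i)).
pose u := y *m invmx P.
have yE : y = u *m P by rewrite mulmxKV.
have dP z w : dotc (z *m P) (w *m P) = dotc z w.
  rewrite adj -mulmxA -/(map_mx _ _); move/unitarymxP: Pu => ->.
  by rewrite mulmx1.
have -> : sqn y = sqn u by rewrite /sqn {1 2}yE dP.
have -> : dotc (y *m B) y = dotc (u *m diag_mx sp) u.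
  by rewrite {2}yE BE mulmxA dP mulmxA.
rewrite /dotc sqnE mulr_sumr.
have -> : \sum_k (u *m diag_mx sp) 0 k * (u 0 k)^*%C =
    real_complex R (\sum_k complex.Re (sp 0 k) * (complex.Re (u 0 k) ^+ 2 + complex.Im (u 0 k) ^+ 2)).
  rewrite rmorph_sum; apply: eq_bigr => k _.
  by rewrite mul_mx_diag mxE mulrAC mulJ_toC mulrC rmorphM /= -(Im0_toC (sp_real k)).
apply: ler_sum => k _; rewrite ler_wpM2r// addr_ge0 ?sqr_ge0//.
Qed.

(** * From characteristic polynomials back to forms on the blocks *)

Section ColourClass.
Variables (R : rcfType) (n r : nat).
Local Notation C := R[i].
Local Notation toC := (real_complex R).
Local Notation Re := (@complex.Re R).
Local Notation Im := (@complex.Im R).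
Variables (A : 'M[C]_n) (c : 'I_n -> 'I_r).

Lemma class_form_le (lam : R) (j : 'I_r) (y : 'rV[C]_n) : hermitian A -> 0 <= lam ->
    (forall x, lam < x -> (char_poly (row_scale A (fun i => (c i == j)%:R))).[toC x] != 0) ->
    (forall k, c k != j -> y 0 k = 0) ->
  Re (dotc (y *m A) y) <= lam * sqn y.
Proof.
move=> hA lam0 Hx yj.
pose B : 'M[C]_n := \matrix_(i, k) ((c i == j)%:R * (c k == j)%:R * A i k).
have BE : dotc (y *m A) y = dotc (y *m B) y.
  rewrite /dotc; apply: eq_bigr => k _; case: (eqVneq (c k) j) => [ck|/yj ->]; last first.
    by rewrite rmorph0 !mulr0.
  congr (_ * _); rewrite !mxE; apply: eq_bigr => i _; rewrite mxE ck eqxx mulr1.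
  by case: (eqVneq (c i) j) => [_|/yj ->]; rewrite ?mul1r ?mul0r.
rewrite BE; apply: hermitian_form_le.
  move=> i k; rewrite !mxE rmorphM rmorphM !rmorph_nat hA; congr (_ * _).
  exact: mulrC.
move=> x w lx wB; have x0 : toC x != 0.
  by rewrite -(rmorph0 toC) (inj_eq (@complexI _)) gt_eqF// (le_lt_trans lam0).
have wj k : c k != j -> w 0 k = 0.
  move=> ck; have := congr1 (fun M : 'rV[C]_n => M 0 k) wB; rewrite !mxE big1 => [/esym/eqP|i _].
    by rewrite mulf_eq0 (negbTE x0) => /eqP.
  by rewrite mxE (negbTE ck) mulr0 mul0r mulr0.
have wA k : c k = j -> (w *m A) 0 k = toC x * w 0 k.
  move=> ck; have := congr1 (fun M : 'rV[C]_n => M 0 k) wB; rewrite !mxE => <-.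
  apply: eq_bigr => i _; rewrite mxE ck eqxx mulr1.
  by case: (eqVneq (c i) j) => [_|/wj ->]; rewrite ?mul1r ?mul0r.
apply/eqP; apply: contraT => w0; have := Hx x lx.
rewrite -[_ == 0]/(root _ _) -eigenvalue_root_char => /eigenvalueP; case.
(* [w] is an eigenvector of the two-sided compression of [A] to the class, whereas [w A] is one of
   the row-scaled matrix. *)
exists (w *m A).
  apply/rowP => k; rewrite [LHS]mxE [RHS]mxE [X in _ = _ * X]mxE mulr_sumr.
  apply: eq_bigr => i _; rewrite [X in _ * X = _]mxE; case: (eqVneq (c i) j) => [ci|ci].
    by rewrite wA// mul1r mulrA.
  by rewrite wj// !mul0r !mulr0.
apply: contra w0 => /eqP wA0; apply/eqP/rowP => k; rewrite [RHS]mxE.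
case: (eqVneq (c k) j) => [ck|/wj//].
by have /eqP := wA k ck; rewrite wA0 mxE eq_sym mulf_eq0 (negbTE x0) => /eqP.
Qed.

End ColourClass.

Theorem paving (R : rcfType) n r (A : 'M[R[i]]_n) (delta theta : R) :
    contraction A -> 0 < delta -> delta <= 2 -> (forall i, complex.Re (A i i) <= delta) ->
    0 < theta -> theta <= 1 -> 10 / theta ^+ 2 < r%:R ->
  exists c : 'I_n -> 'I_r, forall (j : 'I_r) (y : 'rV[R[i]]_n),
    (forall k, c k != j -> y 0 k = 0) ->
    complex.Re (dotc (y *m A) y) <= (delta + theta) * sqn y.
Proof.
move=> cA d_gt0 d_le2 Adelta t_gt0 t_le1 rt.
have r_gt0 : (0 < r)%N.
  by rewrite -(ltr0n R); apply: le_lt_trans rt; rewrite divr_ge0// sqr_ge0.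
case: (posnP n) => [n0|n_gt0].
  exists (fun=> Ordinal r_gt0) => j y _.
  rewrite (_ : y = 0) ?mul0mx; last by apply/rowP => k; have := ltn_ord k; rewrite {2}n0.
  by rewrite sqnE /dotc !big1 ?mulr0// => k _; rewrite !mxE ?mul0r //= expr0n addr0.
(* [d] solves [d * (1 - 1 / tau) = 1], the condition of the barrier step. Since [delta <= 2],
   [tau * delta] exceeds [delta] by at most [theta / 2]; since [d <= 5 / theta] and
   [r > 10 / theta ^+ 2], the term [d / r] is below [theta / 2]. *)
pose tau := 1 + theta / 4; pose d := tau / (tau - 1).
have tau_gt0 : 0 < tau by rewrite /tau; lra.
have tau1 : tau - 1 = theta / 4 by rewrite /tau; lra.
have tau1_gt0 : 0 < tau - 1 by rewrite tau1; lra.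
have d0 : 0 <= d by rewrite divr_ge0// ltW.
have dr : d / r%:R + tau * delta < delta + theta.
  have h1 : d / r%:R < theta / 2.
    rewrite ltr_pdivrMr ?ltr0n// /d ltr_pdivrMr// tau1.
    have : 10 < theta ^+ 2 * r%:R by rewrite mulrC -ltr_pdivrMr// exprn_gt0.
    by rewrite /tau expr2 => h; lra.
  have h2 : theta * delta <= theta * 2 by rewrite ler_pM2l.
  by move: h1; rewrite /tau; lra.
have dphi : 1 <= d * (1 - tau^-1).
  by rewrite le_eqVlt; apply/orP; left; apply/eqP; rewrite /d; field; rewrite !lt0r_neq0.
have rsp := det_poly_stable r cA.
have ry : real_pt (real_complex R (- d) *: \sum_(k < n) dir R r k).
  move=> i j; rewrite mxE summxE mulrC ImMr Im_sum big1 ?mul0r// => k _.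
  by rewrite dirE.
have H x : delta + theta <= x ->
    0 < complex.Re (average (index_enum 'I_n) (det_poly A (r := r)) 0).[real_complex R x].
  move=> lx; have ab := above_roots_start cA d_gt0 Adelta n_gt0 r_gt0 d0 tau_gt0 (lt_le_trans dr lx).
  have := above_roots_average (index_enum 'I_n) r_gt0 rsp ry d0 dphi ab.
  rewrite -scalerDl -rmorphD addNr rmorph0 scale0r => /(_ (fun=> 0) (fun=> lexx _)) [+ _].
  by rewrite big1 ?addr0// => k _; rewrite rmorph0 scale0r.
have r0 : real_pt (0 : 'M[R[i]]_(n, r)) by move=> i j; rewrite mxE.
have [c Hc] := select_colouring r_gt0 rsp r0 (index_enum_uniq _) H.
exists c => j y yj; apply: (class_form_le (c := c) (j := j)) => //.
- by have [] := cA.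
- by rewrite addr_ge0// ltW.
(* The matrix [v] has [-1] at each [(a, c a)] and [0] elsewhere, so a root of the block [j] beyond
   the bound would annihilate the whole product. *)
- move=> x lx; apply/eqP => cx0; have := Hc x (ltW lx).
  set v : 'M[R[i]]_(n, r) := 0 - _.
  have vE a : v a j = - (c a == j)%:R.
    rewrite /v sub0r mxE summxE (bigD1 a isT) big1; last first.
      by move=> k /negbTE ka; rewrite mxE [a == k]eq_sym ka.
    by rewrite /= addr0 mxE eqxx [j == _]eq_sym.
  clearbody v; have vA : row_scale A (fun i => (c i == j)%:R) = - row_scale A (fun i => v i j).
    by apply/matrixP => a b; rewrite !mxE vE mulNr opprK.
  rewrite vA in cx0.
  have -> : (det_poly A v).[real_complex R x] = 0.
    rewrite horner_prod; apply/eqP; rewrite prodf_seq_eq0; apply/hasP.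
    by exists j; rewrite ?mem_index_enum// cx0 eqxx.
  by rewrite ltxx.
Qed.

(** * Trigonometric polynomials on a measurable set *)

Section LebesgueIntegral.
Context {R : realType}.
Local Notation cmu := (@completed_lebesgue_measure R).
Local Notation T := (lebesgueType R).
Local Notation I := (`[0, 1]%classic : set T).

Lemma measurable_lebesgue_id :
  measurable_fun [set: T] (idfun : T -> measurableTypeR R).
Proof. by move=> _ Y mY; rewrite setTI; apply: sub_caratheodory. Qed.

Lemma measurable_fun_lebesgue d (Y : measurableType d) (f : measurableTypeR R -> Y) (D : set T) :
  measurable_fun setT f -> measurable D -> measurable_fun D (f : T -> Y).
Proof.
move=> mf mD; apply: (@measurable_funS _ _ _ _ setT) => //.
by apply: (measurableT_comp mf measurable_lebesgue_id).
Qed.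

Lemma measurable_I : measurable I.
Proof. by apply: sub_caratheodory; apply: measurable_itv. Qed.

Lemma completed_lebesgue_measureE (A : set R) : cmu A = @lebesgue_measure R A.
Proof. by []. Qed.

Lemma cmu_I : cmu I = 1%E.
Proof.
by rewrite completed_lebesgue_measureE lebesgue_measure_itv /= lte01 oppr0 adde0.
Qed.

Lemma cmu_fin (D : set T) : measurable D -> D `<=` I -> (cmu D < +oo)%E.
Proof.
move=> mD DI; apply: (@le_lt_trans _ _ (cmu I)); last by rewrite cmu_I ltry.
by apply: le_measure => //; rewrite inE//; apply: measurable_I.
Qed.

Lemma bounded_integrable (D : set T) (f : T -> R) (M : R) :
    measurable D -> D `<=` I -> measurable_fun D f -> (forall x, `|f x| <= M) ->
  cmu.-integrable D (EFin \o f).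
Proof.
move=> mD DI mf fM; apply: measurable_bounded_integrable => //.
  exact: cmu_fin.
exists M; split; first exact: num_real.
by move=> x Mx y _ /=; rewrite (le_trans (fM y))// ltW.
Qed.

(** The identity pushes the completed measure forward to the Borel one, over which the fundamental
    theorem of calculus is applied. *)
Lemma Rintegral_lebesgue (f : R -> R) (M : R) : measurable_fun [set: measurableTypeR R] f ->
    (forall x, `|f x| <= M) ->
  (\int[cmu]_(x in I) f x = \int[@lebesgue_measure R]_(x in `[0, 1]) f x)%R.
Proof.
move=> mf fM; congr fine.
have mI : measurable (`[0, 1]%classic : set (measurableTypeR R)) by apply: measurable_itv.
have := @integral_pushforward _ _ T (measurableTypeR R) R idfun measurable_lebesgue_id cmu `[0, 1]%classic (EFin \o f) _ _ mI.
move=> <-.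
- apply: eq_measure_integral; first exact: measurable_lebesgue_id.
  by move=> *.
- by apply/measurable_EFinP.
- apply: (bounded_integrable measurable_I) => //.
  exact: (measurable_fun_lebesgue mf measurable_I).
Qed.


Lemma is_derive_scale_arg (a x : R) (f : R -> R) (df : R) :
  is_derive (a * x) (1 : R) f df -> is_derive x (1 : R) (fun y => f (a * y)) (a * df).
Proof.
move=> Hf.
have Ha : is_derive x (1 : R) (fun y => a * y) a.
  by have := is_deriveZ a (is_derive_id x (1 : R)); rewrite /GRing.scale /= mulr1.
have := @is_derive1_comp _ f (fun y => a * y) x df a Hf Ha.
by rewrite mulrC.
Qed.

Lemma Rintegral_derive (F f : R -> R) : (forall x, is_derive x (1 : R) F (f x)) -> continuous f ->
  (\int[@lebesgue_measure R]_(x in `[0, 1]) f x)%R = F 1 - F 0.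
Proof.
move=> dF cf.
have cF : continuous F.
  move=> x; apply: differentiable_continuous; apply/derivable1_diffP.
  exact: (@ex_derive _ _ _ _ _ _ _ (dF x)).
rewrite /Rintegral (@continuous_FTC2 _ f F 0 1)//.
- exact: continuous_subspaceT.
- split.
  + by move=> x _; exact: (@ex_derive _ _ _ _ _ _ _ (dF x)).
  + by apply: cvg_at_right_filter; apply: cF.
  + by apply: cvg_at_left_filter; apply: cF.
- by move=> x _; rewrite derive1E; apply: derive_val.
Qed.

Definition freq (k : int) : R := 2 * pi * k%:~R.

Lemma freq_neq0 k : k != 0 -> freq k != 0.
Proof.
by move=> k0; rewrite /freq !mulf_eq0 !negb_or intr_eq0 k0 pnatr_eq0 (gt_eqF (pi_gt0 _)).
Qed.

Lemma sin_freq k : sin (freq k) = 0.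
Proof.
have H (n : nat) : sin (2 * pi * n%:R) = 0 :> R.
  have := periodicn (@sinD2pi R) n 0; rewrite add0r sin0 => <-; congr sin.
  by rewrite -[RHS]mulr_natr -[X in _ = X * _]mulr_natl.
case: k => n; rewrite /freq; first exact: H.
by rewrite NegzE mulrNz mulrN sinN H oppr0.
Qed.

Lemma cos_freq k : cos (freq k) = 1.
Proof.
have H (n : nat) : cos (2 * pi * n%:R) = 1 :> R.
  have := periodicn (@cosD2pi R) n 0; rewrite add0r cos0 => H1; rewrite -[RHS]H1; congr cos.
  by rewrite -[RHS]mulr_natr -[X in _ = X * _]mulr_natl.
case: k => n; rewrite /freq; first exact: H.
by rewrite NegzE mulrNz mulrN cosN H.
Qed.

Lemma continuous_cos_freq k : continuous (fun x : R => cos (freq k * x)).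
Proof.
move=> x; apply: (@continuous_comp _ _ _ (fun y : R => freq k * y) (@cos R)).
  exact: mulrl_continuous.
exact: continuous_cos.
Qed.

Lemma continuous_sin_freq k : continuous (fun x : R => sin (freq k * x)).
Proof.
move=> x; apply: (@continuous_comp _ _ _ (fun y : R => freq k * y) (@sin R)).
  exact: mulrl_continuous.
exact: continuous_sin.
Qed.

Lemma measurable_cos_freq k (D : set T) : measurable D ->
  measurable_fun D ((fun x => cos (freq k * x)) : T -> R).
Proof.
by apply: measurable_fun_lebesgue; apply: continuous_measurable_fun; apply: continuous_cos_freq.
Qed.

Lemma measurable_sin_freq k (D : set T) : measurable D ->
  measurable_fun D ((fun x => sin (freq k * x)) : T -> R).
Proof.
by apply: measurable_fun_lebesgue; apply: continuous_measurable_fun; apply: continuous_sin_freq.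
Qed.

Lemma Rintegral_cos_freq k : (\int[cmu]_(x in I) cos (freq k * x) = (k == 0)%:R)%R.
Proof.
rewrite (@Rintegral_lebesgue _ 1); last by move=> x; rewrite ler_norml cos_le1 cos_geN1.
  have cc := @continuous_cos_freq k.
  case: (eqVneq k 0) cc => [->|k0] cc.
    have H x : is_derive x (1 : R) id (cos (freq 0 * x)).
      by rewrite /freq mulr0 mul0r cos0; apply: is_derive_id.
    by rewrite (Rintegral_derive H) ?subr0.
  have f0 := freq_neq0 k0.
  have H x : is_derive x (1 : R) (fun x => (freq k)^-1 * sin (freq k * x)) (cos (freq k * x)).
    have := is_deriveZ (freq k)^-1 (is_derive_scale_arg (is_derive_sin (freq k * x))).
    by rewrite /GRing.scale /= mulKf.
  by rewrite (Rintegral_derive H)// mulr1 mulr0 sin0 sin_freq !mulr0 subrr.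
by apply: continuous_measurable_fun; apply: continuous_cos_freq.
Qed.

Lemma Rintegral_sin_freq k : (\int[cmu]_(x in I) sin (freq k * x) = 0)%R.
Proof.
rewrite (@Rintegral_lebesgue _ 1); last by move=> x; rewrite ler_norml sin_le1 sin_geN1.
  have cc := @continuous_sin_freq k.
  case: (eqVneq k 0) cc => [->|k0] cc.
    have H x : is_derive x (1 : R) (cst 0) (sin (freq 0 * x)).
      by rewrite /freq mulr0 mul0r sin0; apply: is_derive_cst.
    by rewrite (Rintegral_derive H) ?subr0.
  have f0 := freq_neq0 k0.
  have H x : is_derive x (1 : R) (fun x => - (freq k)^-1 * cos (freq k * x)) (sin (freq k * x)).
    have := is_deriveZ (- (freq k)^-1) (is_derive_scale_arg (is_derive_cos (freq k * x))).
    by rewrite /GRing.scale /= mulrN mulNr mulrN opprK mulKf.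
  by rewrite (Rintegral_derive H)// mulr1 mulr0 cos0 cos_freq subrr.
by apply: continuous_measurable_fun; apply: continuous_sin_freq.
Qed.

Local Notation C := R[i].
Local Notation toC := (real_complex R).
Local Notation Re := (@complex.Re R).
Local Notation Im := (@complex.Im R).

Definition abs2 (z : C) : R := Re z ^+ 2 + Im z ^+ 2.

Lemma abs2_ge0 z : 0 <= abs2 z.
Proof. by rewrite addr_ge0 ?sqr_ge0. Qed.

Lemma abs2E z : abs2 z = Re (z * z^*%C).
Proof. by rewrite mulJ_toC. Qed.

Lemma expiE k (x : R) : expi k x = (cos (freq k * x) +i* sin (freq k * x))%C.
Proof. by []. Qed.

Lemma expi_mulJ k l (x : R) : expi k x * (expi l x)^*%C = expi (k - l) x.
Proof.
rewrite !expiE /freq rmorphB /= mulrBr mulrBl cosB sinB.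
apply/eqP; rewrite eq_complex /=; apply/andP; split; apply/eqP; ring.
Qed.

Lemma Rintegral_linear (J : Type) (s : seq J) (D : set T) (f : J -> T -> R) :
    measurable D -> (forall j, cmu.-integrable D (EFin \o f j)) ->
  cmu.-integrable D (EFin \o (fun x => \sum_(j <- s) f j x)) /\
  (\int[cmu]_(x in D) (\sum_(j <- s) f j x) = \sum_(j <- s) \int[cmu]_(x in D) f j x)%R.
Proof.
move=> mD intf; elim: s => [|j s [IH1 IH2]].
  split.
    apply: (eq_integrable mD (cst 0%E)); last exact: integrable0.
    by move=> x _ /=; rewrite big_nil.
  rewrite big_nil /Rintegral (_ : (\int[cmu]_(x in D) _)%E = 0%E)//.
  by apply: integral0_eq => x _; rewrite big_nil.
split.
  apply: (eq_integrable mD (fun x => (f j x)%:E + (\sum_(j <- s) f j x)%R%:E)%E).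
    by move=> x _ /=; rewrite big_cons EFinD.
  exact: (integrableD mD (intf j) IH1).
rewrite big_cons -IH2 -RintegralD//; apply: eq_Rintegral => x _.
by rewrite big_cons.
Qed.

Definition sqint (D : set T) (g : R -> C) : R := (\int[cmu]_(x in D) abs2 (g x))%R.

(** The integral of [expi k] over [D]; the inner product of [expi m] and [expi l] on [D] is its
    value at [m - l]. *)
Definition gram (D : set T) (k : int) : C :=
  ((\int[cmu]_(x in D) cos (freq k * x))%R +i* (\int[cmu]_(x in D) sin (freq k * x))%R)%C.

Section OnSet.
Variable D : set T.
Hypotheses (mD : measurable D) (DI : D `<=` I).

Lemma integrable_cos k : cmu.-integrable D (EFin \o (fun x => cos (freq k * x))).
Proof.
apply: (bounded_integrable (M := 1) mD DI); first exact: measurable_cos_freq.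
by move=> x; rewrite ler_norml cos_le1 cos_geN1.
Qed.

Lemma integrable_sin k : cmu.-integrable D (EFin \o (fun x => sin (freq k * x))).
Proof.
apply: (bounded_integrable (M := 1) mD DI); first exact: measurable_sin_freq.
by move=> x; rewrite ler_norml sin_le1 sin_geN1.
Qed.

Lemma integrable_wave (w : C) k :
  cmu.-integrable D (EFin \o (fun x => Re (w * expi k x))) /\
  (\int[cmu]_(x in D) Re (w * expi k x) = Re (w * gram D k))%R.
Proof.
have E : (fun x => Re (w * expi k x)) =
    (fun x => Re w * cos (freq k * x) + (- Im w) * sin (freq k * x)).
  by apply/funext => x; rewrite expiE; case: w => a b /=; ring.
have i1 : cmu.-integrable D (EFin \o (fun x => Re w * cos (freq k * x))).
  exact: (integrableZl mD (Re w) (integrable_cos k)).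
have i2 : cmu.-integrable D (EFin \o (fun x => - Im w * sin (freq k * x))).
  exact: (integrableZl mD (- Im w) (integrable_sin k)).
rewrite E; split; first exact: (integrableD mD i1 i2).
rewrite RintegralD// RintegralZl//; last exact: integrable_cos.
rewrite RintegralZl//; last exact: integrable_sin.
by rewrite /gram; case: (w) => a b /=; ring.
Qed.

Lemma gram_hermitian n (nu : 'I_n -> int) :
  hermitian (\matrix_(i, k) gram D (nu i - nu k)).
Proof.
move=> i k; rewrite !mxE /gram.
have fE x : freq (nu k - nu i) * x = - (freq (nu i - nu k) * x).
  by rewrite -opprB /freq rmorphN /= mulrN mulNr.
apply/eqP; rewrite eq_complex /=; apply/andP; split; apply/eqP.
  by apply: eq_Rintegral => x _; rewrite fE cosN.
rewrite -mulN1r -RintegralZl//; last exact: integrable_sin.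
by apply: eq_Rintegral => x _; rewrite fE sinN mulN1r.
Qed.

Lemma sqint_trig n (nu : 'I_n -> int) (y : 'rV[C]_n) :
  let p := fun x => \sum_i y 0 i * expi (nu i) x in
  cmu.-integrable D (EFin \o (fun x => abs2 (p x))) /\
  sqint D p = Re (dotc (y *m (\matrix_(i, k) gram D (nu i - nu k))) y).
Proof.
move=> p.
pose w (u : 'I_n * 'I_n) := y 0 u.1 * (y 0 u.2)^*%C.
have pE : (fun x => abs2 (p x)) =
    (fun x => \sum_(u : 'I_n * 'I_n) Re (w u * expi (nu u.1 - nu u.2) x)).
  apply/funext => x; rewrite abs2E /p rmorph_sum mulr_suml.
  rewrite -(pair_bigA _ (fun i k => Re (w (i, k) * expi (nu i - nu k) x))) /= Re_sum.
  apply: eq_bigr => i _; rewrite mulr_sumr Re_sum; apply: eq_bigr => k _.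
  by rewrite -expi_mulJ rmorphM mulrACA.
have [H1 H2] := Rintegral_linear (index_enum ('I_n * 'I_n)%type) mD
  (fun u => proj1 (integrable_wave (w u) (nu u.1 - nu u.2))).
rewrite /sqint pE; split=> //; rewrite H2.
rewrite -(pair_bigA _ (fun i k => \int[cmu]_(x in D) Re (w (i, k) * expi (nu i - nu k) x))%R) /=.
rewrite exchange_big /= /dotc.
rewrite Re_sum; apply: eq_bigr => k _; rewrite mxE mulr_suml Re_sum; apply: eq_bigr => i _.
by rewrite (proj2 (integrable_wave _ _)) mxE /w mulrAC.
Qed.

End OnSet.

Lemma gram_I k : gram I k = (k == 0)%:R.
Proof.
rewrite /gram Rintegral_cos_freq Rintegral_sin_freq.
by case: (k == 0).
Qed.

Lemma gram0 (D : set T) : measurable D -> gram D 0 = toC (fine (cmu D)).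
Proof.
move=> mD; rewrite /gram /Rintegral.
under eq_integral do rewrite /freq mulr0 mul0r cos0.
under [in X in (_ +i* X)%C]eq_integral do rewrite /freq mulr0 mul0r sin0.
by rewrite integral0 integral_cst// mul1e.
Qed.

Lemma sqint_ge0 (D : set T) g : 0 <= sqint D g.
Proof. by apply: Rintegral_ge0 => x _; apply: abs2_ge0. Qed.

Lemma sqint_le (D : set T) (g : R -> C) : measurable D -> D `<=` I ->
  cmu.-integrable I (EFin \o (fun x => abs2 (g x))) -> sqint D g <= sqint I g.
Proof.
move=> mD DI ig; have igD := integrableS measurable_I mD DI ig.
rewrite /sqint /Rintegral fine_le//.
- exact: integrable_fin_num.
- by apply: integrable_fin_num => //; apply: measurable_I.
- apply: ge0_subset_integral; [exact: mD|exact: measurable_I| | |exact: DI].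
    by have /integrableP[] := ig.
  by move=> x _; rewrite lee_fin abs2_ge0.
Qed.

Lemma matrix_gram_I n (nu : 'I_n -> int) : injective nu ->
  \matrix_(i, k) gram I (nu i - nu k) = 1%:M :> 'M[C]_n.
Proof.
move=> inu; apply/matrixP => i k; rewrite !mxE gram_I subr_eq0.
by rewrite (inj_eq inu).
Qed.

(** * Gram matrices of finitely many frequencies *)

Section Window.
Variable E : set T.
Hypotheses (mE : measurable E) (EI : E `<=` I).
Variables (n : nat) (nu : 'I_n -> int).
Hypothesis inu : injective nu.
Local Notation A := (\matrix_(i, k) gram E (nu i - nu k) : 'M[C]_n).

Lemma sqint_I_trig (y : 'rV[C]_n) : sqint I (fun x => \sum_i y 0 i * expi (nu i) x) = sqn y.
Proof.
have [_ ->] := sqint_trig measurable_I (fun _ h => h) nu y.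
by rewrite matrix_gram_I// mulmx1.
Qed.

(** The form at [y] is the integral over [E] of the squared modulus of a trigonometric polynomial,
    and over [[0, 1]] that integral is [sqn y] by orthonormality. *)
Lemma contraction_gram : contraction A.
Proof.
split; first exact: gram_hermitian.
move=> y; have [_ <-] := sqint_trig mE EI nu y.
rewrite sqint_ge0 -sqint_I_trig; apply: sqint_le => //.
by have [] := sqint_trig measurable_I (fun _ h => h) nu y.
Qed.

Lemma form_complement (y : 'rV[C]_n) :
  Re (dotc (y *m (1%:M - A)) y) = sqn y - Re (dotc (y *m A) y).
Proof.
rewrite mulmxBr mulmx1 dotcBl /sqn.
by case: (dotc y y) (dotc (_ *m _) y) => ? ? [? ?].
Qed.

Lemma contraction_complement : contraction (1%:M - A).
Proof.
have [hA psd] := contraction_gram; split.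
  have e (a b : 'I_n) : (1%:M - A) a b = (a == b)%:R - A a b.
    by rewrite [LHS]mxE [1%:M a b]mxE [(- A) a b]mxE.
  by move=> i k; rewrite !e rmorphB rmorph_nat hA eq_sym.
move=> y; have := psd y; rewrite form_complement => /andP[? ?].
by rewrite subr_ge0; apply/andP; split=> //; rewrite gerBl.
Qed.

Lemma paving_window (r : nat) (theta : R) : 0 < fine (cmu E) -> fine (cmu E) <= 1 ->
    0 < theta -> theta <= 1 -> 40 / theta ^+ 2 < r%:R ->
  exists c : 'I_n -> 'I_r * 'I_r, forall j (y : 'rV[C]_n),
    (forall k, c k != j -> y 0 k = 0) ->
    let p := fun x => \sum_i y 0 i * expi (nu i) x in
    (fine (cmu E) - theta) * sqint I p <= sqint E p <= (fine (cmu E) + theta) * sqint I p.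
Proof.
set delta := fine (cmu E) => d_gt0 d_le1 t_gt0 t_le1 rt.
have t2_gt0 : 0 < theta / 2 by rewrite divr_gt0.
have t2_le1 : theta / 2 <= 1 by lra.
have rt2 : 10 / (theta / 2) ^+ 2 < r%:R.
  by apply: le_lt_trans rt; rewrite le_eqVlt; apply/orP; left; apply/eqP; field; rewrite gt_eqF.
have AE i : Re (A i i) = delta by rewrite mxE subrr gram0.
have [|i|c1 Hc1] := paving contraction_gram d_gt0 _ _ t2_gt0 t2_le1 rt2.
- by lra.
- by rewrite AE.
(* The diagonal entry [1 - delta] of the complement vanishes when [E] has full measure. Adding
   [theta / 2] makes the parameter positive, and the total excess is still [theta]. *)
have [| |i|c2 Hc2] := paving (delta := 1 - delta + theta / 2) contraction_complement _ _ _ t2_gt0 t2_le1 rt2.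
- by lra.
- by lra.
- rewrite [_ i i]mxE [X in X + _]mxE eqxx [X in _ + X]mxE.
  have := AE i; case: (A i i) => a b /= ->; lra.
exists (fun k => (c1 k, c2 k)) => -[j1 j2] y yj /=.
have [_ pE] := sqint_trig mE EI nu y.
rewrite pE sqint_I_trig.
have y1 k : c1 k != j1 -> y 0 k = 0.
  by move=> ck; apply: yj; apply: contra ck => /eqP[-> _].
have y2 k : c2 k != j2 -> y 0 k = 0.
  by move=> ck; apply: yj; apply: contra ck => /eqP[_ ->].
have h1 := Hc1 j1 y y1.
have h2 := Hc2 j2 y y2.
rewrite (form_complement y) in h2.
have s0 := sqn_ge0 y; have ts : 0 <= theta * sqn y by rewrite mulr_ge0// ltW.
by apply/andP; split; lra.
Qed.

End Window.

(** * From finite windows to all frequencies *)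

Definition trig (s : seq int) (y : int -> C) : R -> C :=
  fun x => \sum_(m <- s) y m * expi m x.

Definition frame_bounds (E : set T) (theta : R) (s : seq int) := forall y : int -> C,
  (fine (cmu E) - theta) * sqint I (trig s y) <= sqint E (trig s y) <=
  (fine (cmu E) + theta) * sqint I (trig s y).

Lemma paving_seq (E : set T) (r : nat) (theta : R) (W : seq int) :
    measurable E -> E `<=` I -> 0 < fine (cmu E) -> fine (cmu E) <= 1 ->
    0 < theta -> theta <= 1 -> 40 / theta ^+ 2 < r%:R -> uniq W ->
  exists c : int -> 'I_r * 'I_r, forall j s, uniq s -> {subset s <= W} ->
    (forall m, m \in s -> c m = j) -> frame_bounds E theta s.
Proof.
move=> mE EI d_gt0 d_le1 t_gt0 t_le1 rt uW.
pose nu : 'I_(size W) -> int := tnth (in_tuple W).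
have inu : injective nu by apply/tuple_uniqP.
have [c0 Hc] := paving_window mE EI inu d_gt0 d_le1 t_gt0 t_le1 rt.
have r_gt0 : (0 < r)%N.
  by rewrite -(ltr0n R); apply: le_lt_trans rt; rewrite divr_ge0// sqr_ge0.
(* Frequencies outside [W] get an arbitrary colour; the sequences [s] stay inside [W]. *)
pose c m := if [pick i | nu i == m] is Some i then c0 i else (Ordinal r_gt0, Ordinal r_gt0).
have cnu i : c (nu i) = c0 i.
  by rewrite /c; case: pickP => [i' /eqP/inu ->//|/(_ i)]; rewrite eqxx.
exists c => j s us sW cs y.
pose yv : 'rV[C]_(size W) := \row_i (if nu i \in s then y (nu i) else 0).
have -> : trig s y = (fun x => \sum_i yv 0 i * expi (nu i) x).
  apply/funext => x; rewrite /trig.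
  have ps : perm_eq s [seq m <- map nu (index_enum 'I_(size W)) | m \in s].
    apply: uniq_perm => //; first by rewrite filter_uniq// map_inj_uniq// index_enum_uniq.
    move=> m; rewrite mem_filter; case: (boolP (m \in s)) => //= ms; apply/esym.
    have /tnthP[i ->] : m \in in_tuple W by apply: sW.
    by rewrite map_f// mem_index_enum.
  rewrite (perm_big _ ps) big_filter big_map big_mkcond; apply: eq_bigr => i _.
  by rewrite mxE; case: ifP; rewrite ?mul0r.
apply: (Hc j) => k ck; rewrite mxE; case: ifP => // ks.
by move: ck; rewrite -cnu cs ?eqxx.
Qed.

(** Compactness by an ultrafilter finer than the cofinite filter: as [K] is finite, each [m] has a
    colour taken for a large set of [N], and finitely many large sets meet arbitrarily far out. *)
Lemma colour_limit (K : finType) (c : nat -> int -> K) :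
  exists c' : int -> K, forall s : seq int, forall N0, exists2 N, (N0 <= N)%N &
    forall m, m \in s -> c N m = c' m.
Proof.
have [U [UU leU]] := ultraFilterLemma eventually_filter.
have PU : ProperFilter U by apply: ultra_proper.
have H m : exists k, U [set N | c N m = k].
  apply: contrapT => Hn.
  have Hk k : U [set N | c N m <> k].
    by have [Uk|//] := in_ultra_setVsetC [set N | c N m = k] UU; exfalso; apply: Hn; exists k.
  have Hs (s : seq K) : U [set N | c N m \notin s].
    elim: s => [|k s IH]; first by apply: filterS filterT => N.
    apply: filterS (filterI (Hk k) IH) => N [/= ck cs].
    by rewrite inE negb_or cs andbT; apply/eqP.
  have [N] := filter_ex (Hs (index_enum K)).
  by rewrite /= mem_index_enum.
have [c' Hc'] := choice H.
exists c' => s N0.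
have [N [Ns NN0]] : exists N, (forall m, m \in s -> c N m = c' m) /\ (N0 <= N)%N.
  apply: (@filter_ex _ U); apply: filterI; last first.
    by apply: leU; exists N0.
  elim: s => [|m s IH]; first by apply: filterS filterT => N.
  apply: filterS (filterI (Hc' m) IH) => N [/= cm cs] m'.
  by rewrite inE => /predU1P[->|/cs].
by exists N.
Qed.

(** Elements of [trig_span] may repeat a frequency, while the Gram matrix of a window needs distinct
    ones; repetitions are absorbed into the coefficients. *)
Lemma trig_undup (s : seq int) (y : int -> C) :
  trig s y = trig (undup s) (fun m => y m *+ count_mem m s).
Proof.
apply/funext => x; rewrite /trig -[LHS]big_undup_iterop_count.
by apply: eq_bigr => m _; rewrite mulrnAl; case: (count_mem m s).
Qed.

Lemma exists_colouring (E : set T) (r : nat) (theta : R) :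
    measurable E -> E `<=` I -> 0 < fine (cmu E) -> fine (cmu E) <= 1 ->
    0 < theta -> theta <= 1 -> 40 / theta ^+ 2 < r%:R ->
  exists c : int -> 'I_r * 'I_r, forall j s,
    (forall m, m \in s -> c m = j) -> frame_bounds E theta s.
Proof.
move=> mE EI d_gt0 d_le1 t_gt0 t_le1 rt.
pose W (N : nat) : seq int := undup ([seq Posz i | i <- iota 0 N] ++ [seq Negz i | i <- iota 0 N]).
have WP m : exists N0, forall N, (N0 <= N)%N -> m \in W N.
  case: m => k; exists k.+1 => N kN; rewrite mem_undup mem_cat; apply/orP; [left|right];
    by apply: map_f; rewrite mem_iota.
have /choice[c Hc] : forall N, exists c : int -> 'I_r * 'I_r, forall j s, uniq s -> {subset s <= W N} ->
    (forall m, m \in s -> c m = j) -> frame_bounds E theta s.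
  by move=> N; apply: paving_seq => //; apply: undup_uniq.
have [c' Hc'] := colour_limit c.
exists c' => j s cs y; rewrite trig_undup.
have [N0 HN0] : exists N0, forall N, (N0 <= N)%N -> {subset s <= W N}.
  elim: (s) => [|m s' [N1 H1]]; first by exists 0%N.
  have [N2 H2] := WP m; exists (maxn N1 N2) => N; rewrite geq_max => /andP[h1 h2] m'.
  by rewrite inE => /predU1P[->|]; [apply: H2|apply: H1].
have [N NN0 HN] := Hc' s N0.
apply: (Hc N j); first exact: undup_uniq.
- by move=> m ms; apply: HN0 => //; rewrite -mem_undup.
- by move=> m; rewrite mem_undup => ms; rewrite HN// cs.
Qed.

(** * From trigonometric polynomials to their closed span *)

Definition sq_integrable (g : R -> C) := cmu.-integrable I (EFin \o (fun x => abs2 (g x))).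

Lemma L2norm_sqr (g : R -> C) : (L2norm g ^+ 2 = \int[cmu]_(x in I) (abs2 (g x))%:E)%E.
Proof.
have sqE (x : \bar R) : (0 <= x -> x ^+ 2 = x `^ 2%:R)%E.
  case: x => [x x0|_|//]; last by rewrite expe2 mulyy poweRyr.
  by rewrite -EFin_expe poweR_EFin powR_mulrn.
rewrite sqE; last exact: Lnorm_ge0.
rewrite /L2norm powR_Lnorm// [RHS]integral_mkcond; apply: eq_integral => x _.
rewrite /patch; case: ifP => _; last by rewrite abse0 poweR0r.
rewrite -[`|_|%E]/(`|Normc.normc (g x)|)%:E poweR_EFin powR_mulrn//.
congr EFin; rewrite real_normK ?num_real//.
by rewrite /abs2; case: (g x) => a b /=; rewrite sqr_sqrtr// addr_ge0 ?sqr_ge0.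
Qed.

Lemma L2norm_proj_sqr (E : set T) (g : R -> C) : E `<=` I ->
  (L2norm (restrict_proj E g) ^+ 2 = \int[cmu]_(x in E) (abs2 (g x))%:E)%E.
Proof.
move=> EI; rewrite L2norm_sqr integral_mkcond [RHS]integral_mkcond.
apply: eq_integral => x _; rewrite /patch /restrict_proj indicE.
case: (boolP (x \in E)) => xE.
  rewrite ifT; last by rewrite inE; apply: EI; rewrite inE in xE.
  by rewrite mulr1.
by rewrite rmorph0 mulr0 /abs2 /= expr0n addr0; case: ifP.
Qed.

Lemma sq_integrable_fin (D : set T) g : measurable D -> D `<=` I -> sq_integrable g ->
  (\int[cmu]_(x in D) (abs2 (g x))%:E = (sqint D g)%:E)%E.
Proof.
move=> mD DI ig; rewrite /sqint /Rintegral fineK//.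
by apply: integrable_fin_num => //; apply: (integrableS measurable_I mD DI ig).
Qed.

Lemma measurable_abs2 (g : R -> C) :
    measurable_fun I (fun x => Re (g x) : R) -> measurable_fun I (fun x => Im (g x) : R) ->
  measurable_fun I (fun x => abs2 (g x)).
Proof.
by move=> mr mi; apply: measurable_funD; apply: measurable_funX.
Qed.

Lemma sq_integrable_L2 (g : R -> C) :
    measurable_fun I (fun x => Re (g x) : R) -> measurable_fun I (fun x => Im (g x) : R) ->
  (L2norm g < +oo)%E -> sq_integrable g.
Proof.
move=> mr mi Ng; apply/integrableP; split.
  by apply/measurable_EFinP; apply: measurable_abs2.
under eq_integral do rewrite /= ger0_norm ?abs2_ge0//.
rewrite -L2norm_sqr expe2 lte_mul_pinfty//; first exact: Lnorm_ge0.
by rewrite ge0_fin_numE//; apply: Lnorm_ge0.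
Qed.

Lemma trig_tnth (s : seq int) (y : int -> C) :
  trig s y = fun x => \sum_i (\row_i y (tnth (in_tuple s) i)) 0 i * expi (tnth (in_tuple s) i) x.
Proof.
apply/funext => x; rewrite /trig big_tnth; apply: eq_bigr => i _.
by rewrite mxE.
Qed.

Lemma sq_integrable_trig s y : sq_integrable (trig s y).
Proof.
rewrite trig_tnth.
by have [] := sqint_trig measurable_I (fun _ h => h) (tnth (in_tuple s)) (\row_i y (tnth (in_tuple s) i)).
Qed.

Lemma measurable_Re_trig s y : measurable_fun I (fun x => Re (trig s y x) : R).
Proof.
have [/integrableP[/measurable_EFinP mS _] _] := Rintegral_linear s measurable_I
   (fun m => proj1 (integrable_wave measurable_I (fun _ h => h) (y m) m)).
apply: eq_measurable_fun mS => x _; rewrite /trig.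
by rewrite Re_sum.
Qed.

Lemma measurable_Im_trig s y : measurable_fun I (fun x => Im (trig s y x) : R).
Proof.
have := measurable_Re_trig s (fun m => - 'i%C * y m).
apply: eq_measurable_fun => x _; rewrite /trig.
under eq_bigr do rewrite -mulrA.
by rewrite -mulr_sumr; case: (\sum_(_ <- _) _) => a b /=; ring.
Qed.

(** A weighted inequality for squared norms. If the approximation error is below [eta], the last
    term is at most [eta ^+ 2 + eta], so everything lost tends to zero with [eta]. *)
Lemma sqint_triangle (D : set T) (g h : R -> C) (eta : R) :
    measurable D -> D `<=` I -> 0 < eta ->
    sq_integrable g -> sq_integrable h -> sq_integrable (fun x => g x - h x) ->
  sqint D g <= (1 + eta) * sqint D h + (1 + eta^-1) * sqint D (fun x => g x - h x).
Proof.
move=> mD DI e_gt0 ig ih igh.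
have jg := integrableS measurable_I mD DI ig.
have jh := integrableS measurable_I mD DI ih.
have jgh := integrableS measurable_I mD DI igh.
have kh := integrableZl mD (1 + eta) jh.
have kgh := integrableZl mD (1 + eta^-1) jgh.
rewrite /sqint -!RintegralZl// -RintegralD//.
apply: le_Rintegral => //; first exact: (integrableD mD kh kgh).
move=> x _; move: (g x) (h x) => [a1 a2] [b1 b2]; rewrite /abs2 /=.
have key (a b : R) : a ^+ 2 <= (1 + eta) * b ^+ 2 + (1 + eta^-1) * (a - b) ^+ 2.
  rewrite -subr_ge0; set u := (X in 0 <= X).
  have -> : u = eta^-1 * (eta * b - (a - b)) ^+ 2 by rewrite /u; field; rewrite gt_eqF.
  by rewrite mulr_ge0 ?sqr_ge0// invr_ge0 ltW.
by have := key a1 b1; have := key a2 b2; lra.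
Qed.

(* [eta] is both the accuracy of the approximation and the weight in [sqint_triangle]. *)
Lemma le_limit (U V K1 K2 : R) : 0 <= V -> 0 <= K1 -> 0 <= K2 ->
    (forall eta, 0 < eta -> eta <= 1 ->
       U <= (1 + eta) * ((1 + eta) * V + 2 * eta * K1) + 2 * eta * K2) ->
  U <= V.
Proof.
move=> V0 K10 K20 H; rewrite leNgt; apply/negP => UV.
set M := 3 * V + 4 * K1 + 2 * K2.
have M0 : 0 <= M by rewrite /M; lra.
have M1 : 0 < 2 * (M + 1) by lra.
set eta := Num.min 1 ((U - V) / (2 * (M + 1))).
have e_gt0 : 0 < eta by rewrite lt_min ltr01 divr_gt0// subr_gt0.
have e_le1 : eta <= 1 by rewrite ge_min lexx.
have eM : eta * (2 * (M + 1)) <= U - V by rewrite -ler_pdivlMr// ge_min lexx orbT.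
have := H eta e_gt0 e_le1.
have e2 : eta * eta <= eta by rewrite ger_pMr.
have h1 : eta * eta * V <= eta * V by rewrite ler_wpM2r.
have h2 : eta * eta * K1 <= eta * K1 by rewrite ler_wpM2r.
have h3 : 0 <= eta * M by rewrite mulr_ge0// ltW.
move: eM h3; rewrite /M; nra.
Qed.

Lemma trig_space_bounds (E : set T) (J : set int) (alpha beta : R) (f : R -> C) :
    measurable E -> E `<=` I -> 0 <= beta ->
    (forall s y, [set` s] `<=` J ->
      alpha * sqint I (trig s y) <= sqint E (trig s y) <= beta * sqint I (trig s y)) ->
    trig_space J f ->
  (alpha%:E * L2norm f ^+ 2 <= L2norm (restrict_proj E f) ^+ 2)%E /\
  (L2norm (restrict_proj E f) ^+ 2 <= beta%:E * L2norm f ^+ 2)%E.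
Proof.
move=> mE EI b0 H [[mr [mi Nf]] Hf].
have mI := measurable_I.
have II : I `<=` I by [].
have fI := sq_integrable_L2 mr mi Nf.
rewrite L2norm_proj_sqr// L2norm_sqr !sq_integrable_fin// -!EFinM !lee_fin.
set X := sqint I f; set Y := sqint E f.
(* [P] and [Q] are the analogues of [X] and [Y] for a trigonometric polynomial within [eta] of
   [f]. *)
have approx (eta : R) : 0 < eta -> eta <= 1 -> exists P Q : R,
   [/\ 0 <= P, alpha * P <= Q <= beta * P,
     X <= (1 + eta) * P + 2 * eta /\ P <= (1 + eta) * X + 2 * eta &
     Y <= (1 + eta) * Q + 2 * eta /\ Q <= (1 + eta) * Y + 2 * eta].
  move=> e_gt0 e_le1; have [_ [s [y [sJ ->]]] Ne] := Hf eta e_gt0.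
  rewrite -/(trig s y) in Ne; have pI := sq_integrable_trig s y.
  have ReB (z w : C) : Re (z - w) = Re z - Re w by case: z w => ? ? [].
  have mfp : measurable_fun I (fun x => Re (f x - trig s y x) : R) /\
      measurable_fun I (fun x => Im (f x - trig s y x) : R).
    split.
      have -> : (fun x => Re (f x - trig s y x)) = (fun x => Re (f x) - Re (trig s y x)).
        by apply/funext => x; rewrite ReB.
      exact: (measurable_funB mr (measurable_Re_trig s y)).
    have -> : (fun x => Im (f x - trig s y x)) = (fun x => Im (f x) - Im (trig s y x)).
      by apply/funext => x; rewrite ImB.
    exact: (measurable_funB mi (measurable_Im_trig s y)).
  have fpI : sq_integrable (fun x => f x - trig s y x).
    by apply: sq_integrable_L2; [exact: mfp.1|exact: mfp.2|rewrite (lt_trans Ne)// ltry].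
  have pfE : (fun x => abs2 (trig s y x - f x)) = (fun x => abs2 (f x - trig s y x)).
    by apply/funext => x; case: (trig s y x) (f x) => ? ? [? ?]; rewrite /abs2 /=; ring.
  have pfI : sq_integrable (fun x => trig s y x - f x) by rewrite /sq_integrable pfE.
  have Z : sqint I (fun x => f x - trig s y x) <= eta ^+ 2.
    have := L2norm_sqr (fun x => f x - trig s y x); rewrite sq_integrable_fin// => /esym ZE.
    move: Ne ZE; have := Lnorm_ge0 cmu 2%:E ((fun x => (Normc.normc (f x - trig s y x))%:E) \_ I).
    rewrite -/(L2norm (fun x => f x - trig s y x)).
    case: (L2norm _) => [a|//|//]; rewrite lee_fin lte_fin => a0 ae [->].
    by rewrite -expr2 ler_sqr ?nnegrE// ltW.
  have tri (D : set T) : measurable D -> D `<=` I ->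
      sqint D f <= (1 + eta) * sqint D (trig s y) + 2 * eta /\
      sqint D (trig s y) <= (1 + eta) * sqint D f + 2 * eta.
    move=> mD DI; have ZD := le_trans (sqint_le mD DI fpI) Z.
    have small : (1 + eta^-1) * sqint D (fun x => f x - trig s y x) <= 2 * eta.
      have i_gt0 : 0 < 1 + eta^-1 by rewrite addr_gt0// invr_gt0.
      apply: (le_trans (ler_wpM2l (ltW i_gt0) ZD)).
      have -> : (1 + eta^-1) * eta ^+ 2 = eta ^+ 2 + eta by field; rewrite gt_eqF.
      by have : eta * eta <= eta by [rewrite ger_pMr]; rewrite expr2; lra.
    split.
      by have := sqint_triangle mD DI e_gt0 fI pI fpI; lra.
    have := sqint_triangle mD DI e_gt0 pI fI pfI.
    by rewrite {3}/sqint pfE -/(sqint D _); lra.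
  exists (sqint I (trig s y)), (sqint E (trig s y)); split.
  - exact: sqint_ge0.
  - exact: H.
  - exact: tri.
  - exact: tri.
have X0 : 0 <= X by apply: sqint_ge0.
have Y0 : 0 <= Y by apply: sqint_ge0.
split.
  (* For [eps >= 1] the lower constant is not positive and cannot multiply the approximation
     inequalities, but then the bound is trivial. *)
  case: (leP alpha 0) => a0; first by apply: le_trans Y0; rewrite mulr_le0_ge0.
  apply: (@le_limit _ _ 1 alpha) => //; first exact: ltW.
  move=> eta e_gt0 e_le1; have [P [Q [P0 /andP[h1 h2] [h3 h4] [h5 h6]]]] := approx eta e_gt0 e_le1.
  have k1 := ler_wpM2l (ltW a0) h3.
  have e1 : 0 <= 1 + eta by lra.
  have k2 := ler_wpM2l e1 h1.
  have k3 := ler_wpM2l e1 h6.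
  lra.
apply: (@le_limit _ _ beta 1) => //; first exact: mulr_ge0.
move=> eta e_gt0 e_le1; have [P [Q [P0 /andP[h1 h2] [h3 h4] [h5 h6]]]] := approx eta e_gt0 e_le1.
have e1 : 0 <= 1 + eta by lra.
have k1 := ler_wpM2l e1 h2.
have k2 := ler_wpM2l (mulr_ge0 e1 b0) h4.
lra.
Qed.

End LebesgueIntegral.

Theorem theorem6p2 (R : realType) (E : set R) (eps : R) (r : nat)
  (E01 : E `<=` `[0, 1])
  (mE : lebesgue_measurable E)
  (E_gt0 : 0 < vol E)
  (eps_gt0 : 0 < eps)
  (rE : r%:Z = Num.ceil ((6 * (vol E + 1) / (eps * vol E)) ^+ 8)) :
  exists S : 'I_r -> set int,
    \bigcup_j S j = [set: int] /\
    trivIset [set: 'I_r] S /\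
    forall (j : 'I_r) (f : R -> R[i]), trig_space (S j) f ->
      (((1 - eps) * vol E)%:E * L2norm f ^+ 2 <= L2norm (restrict_proj E f) ^+ 2)%E /\
      (L2norm (restrict_proj E f) ^+ 2 <= ((1 + eps) * vol E)%:E * L2norm f ^+ 2)%E.
Proof.
set delta := vol E in E_gt0 rE *.
have d_le1 : delta <= 1.
  rewrite -lee_fin /delta /vol fineK; last first.
    by rewrite ge0_fin_numE//; apply: cmu_fin.
  by rewrite -(@cmu_I R); apply: le_measure => //; rewrite inE//; apply: measurable_I.
set theta := eps * delta.
have t_gt0 : 0 < theta by rewrite mulr_gt0.
set x := (6 * (delta + 1) / theta) ^+ 8 in rE.
have x_gt0 : 0 < x by rewrite exprn_gt0// divr_gt0// mulr_gt0// addr_gt0.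
have xr : x <= r%:R.
  have := Num.Theory.ceil_ge x; rewrite -rE => /le_trans; apply.
  by rewrite pmulrn.
have r_gt0 : (0 < r)%N by rewrite -(ltr0n R) (lt_le_trans x_gt0).
have bE : (1 + eps) * delta = delta + theta by rewrite mulrDl mul1r.
have aE : (1 - eps) * delta = delta - theta by rewrite mulrBl mul1r.
have b0 : 0 <= delta + theta by rewrite addr_ge0// ltW.
suff [h Hh] : exists h : int -> 'I_r, forall j s y, (forall m, m \in s -> h m = j) ->
    (delta - theta) * sqint `[0, 1] (trig s y) <= sqint E (trig s y) <=
    (delta + theta) * sqint `[0, 1] (trig s y).
  exists (fun j => [set m | h m = j]); split; first by apply/seteqP; split=> // m _; exists (h m).
  split; first by move=> i j _ _ [m [/= <- <-]].
  move=> j f Sf; rewrite aE bE.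
  by apply: trig_space_bounds Sf => // s y sj; apply: (Hh j) => m ms; apply: sj.
have trig_ge0 := fun D s y => @sqint_ge0 R D (trig s y).
(* If [theta >= 1], one class suffices: the lower constant is at most [0] since [delta <= 1], and
   the upper one is at least [1]. *)
have [t1|t1] := leP 1 theta.
  exists (fun=> Ordinal r_gt0) => j s y _; apply/andP; split.
    by apply: le_trans (trig_ge0 E s y); rewrite mulr_le0_ge0//; lra.
  apply: (@le_trans _ _ (sqint `[0, 1] (trig s y))).
    exact: (sqint_le mE E01 (sq_integrable_trig s y)).
  by rewrite ler_peMl//; lra.
pose n := (Num.truncn (40 / theta ^+ 2)).+1.
have t2_gt0 : 0 < theta ^+ 2 by rewrite exprn_gt0.
have y_ge0 : 0 <= 40 / theta ^+ 2 by rewrite divr_ge0// ltW.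
have /andP[n1 n2] := Num.Theory.truncn_itv y_ge0; rewrite -/n in n2.
have [c Hc] := exists_colouring mE E01 E_gt0 d_le1 t_gt0 (ltW t1) n2.
(* With [t = 1 / theta >= 1], [n <= 41 t^2], where the extra [1] is the rounding in [n]. Then [n^2
   <= (41 t^2)^2 <= (36 t^2)^4 = (6 t)^8], and [6 t] is at most the base in the definition of
   [r]. *)
have n_le : (n * n <= r)%N.
  rewrite -(ler_nat R); apply: le_trans xr; rewrite natrM.
  pose t := theta^-1; have t_ge1 : 1 <= t by rewrite invf_ge1// ltW.
  have u1 : 1 <= t ^+ 2 by rewrite exprn_ege1.
  have nt : n%:R <= 41 * t ^+ 2 by rewrite /n -natr1; move: n1; rewrite -exprVn -/t; lra.
  apply: (@le_trans _ _ ((41 * t ^+ 2) * (41 * t ^+ 2))); first by rewrite ler_pM.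
  apply: (@le_trans _ _ ((6 * t) ^+ 8)).
    have -> : (6 * t) ^+ 8 = (36 * t ^+ 2) * (36 * t ^+ 2) * ((36 * t ^+ 2) * (36 * t ^+ 2)).
      have -> : (6 * t) ^+ 8 = (((6 * t) ^+ 2) ^+ 2) ^+ 2 by rewrite -!exprM.
      have -> : (6 * t) ^+ 2 = 36 * t ^+ 2 by ring.
      by rewrite !expr2.
    have u36 : 36 <= 36 * t ^+ 2 by rewrite ler_peMr.
    have v36 : 36 * (36 * t ^+ 2) <= 36 * t ^+ 2 * (36 * t ^+ 2).
      by rewrite ler_wpM2r// (le_trans _ u36).
    have v41 : 41 * t ^+ 2 <= 36 * t ^+ 2 * (36 * t ^+ 2) by apply: le_trans v36; lra.
    have v0 : 0 <= 41 * t ^+ 2 by rewrite mulr_ge0// (le_trans ler01).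
    exact: ler_pM.
  have t0 : 0 < t by rewrite invr_gt0.
  have p6 : 0 <= 6 * t by rewrite mulr_ge0// ltW.
  have le6 : 6 * t <= 6 * (delta + 1) / theta by rewrite -/t ler_pM2r//; lra.
  by rewrite /x lerXn2r// nnegrE (le_trans p6).
have card_le : (#|{: 'I_n * 'I_n}| <= r)%N by rewrite card_prod !card_ord.
(* Pairs of colours are embedded in ['I_r]; indices outside the image give empty classes. *)
pose w u := widen_ord card_le (enum_rank u).
have w_inj : injective w by move=> u v /(congr1 val) /= /val_inj /enum_rank_inj.
exists (fun m => w (c m)) => j s y sj.
(* The pair behind [j] is read off the first frequency of [s]; for empty [s] any pair will do, here
   the colour of [0]. *)
apply: (Hc (c (head 0 s))) => m ms; apply: w_inj; rewrite sj//.
by case: s sj ms => // m' s sj _; rewrite sj// inE eqxx.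
Qed.
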